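(* The quiver settings $(Q,\mathbf{h}_Q)$, where $Q$ is a Euclidean quiver, are precisely the minimal (with respect to the preorder $\leq$ on quiver settings) representation infinite quiver settings.
   Context: Throughout, $k$ is an algebraically closed field, and $\mathbb{N}$ includes $0$. A quiver $Q$ consists of a finite set $Q_0$ of vertices, a finite set $Q_1$ of arrows, and maps $s,t\colon Q_1\to Q_0$ (start and terminal vertex); loops and multiple arrows are allowed. A dimension vector for $Q$ is an element $\mathbf{d}\in\mathbb{N}^{Q_0}$; inequalities between dimension vectors are coordinatewise. A quiver setting is a pair $(Q,\mathbf{d})$ of a quiver and a dimension vector for it. A representation of $Q$ of dimension vector $\mathbf{d}$ is a tuple $M=(M_\alpha)_{\alpha\in Q_1}$ of $k$-linear maps $M_\alpha\colon k^{\mathbf{d}(s\alpha)}\to k^{\mathbf{d}(t\alpha)}$. Two such representations $M,N$ are isomorphic if there is a tuple $g=(g_x)_{x\in Q_0}$ of $k$-linear automorphisms $g_x$ of $k^{\mathbf{d}(x)}$ with $N_\alpha=g_{t\alpha}M_\alpha g_{s\alpha}^{-1}$ for every $\alpha\in Q_1$. The setting $(Q,\mathbf{d})$ is representation finite if there are only finitely many isomorphism classes of representations of $Q$ of dimension vector $\mathbf{d}$, and representation infinite otherwise. A quiver morphism $\psi\colon Q\to Q'$ is a pair of maps $\psi_0\colon Q_0\to Q_0'$, $\psi_1\colon Q_1\to Q_1'$ with $s(\psi_1\alpha)=\psi_0(s\alpha)$ and $t(\psi_1\alpha)=\psi_0(t\alpha)$ for all $\alpha \in Q_1$; it is injective if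 both $\psi_0,\psi_1$ are injective. For quiver settings, $(Q,\mathbf{d})\leq(Q',\mathbf{d}')$ means that there is an injective quiver morphism $\psi\colon Q\to Q'$ with $\mathbf{d}(x)\leq\mathbf{d}'(\psi_0 x)$ for all $x\in Q_0$. This relation is a preorder. A representation infinite quiver setting $(Q,\mathbf{d})$ is minimal if every representation infinite quiver setting $(Q',\mathbf{d}')$ with $(Q',\mathbf{d}')\leq(Q,\mathbf{d})$ also satisfies $(Q,\mathbf{d})\leq(Q',\mathbf{d}')$. A Euclidean quiver $Q$ is a quiver whose underlying graph (forget the orientation of arrows) is one of the following; the vector $\mathbf{h}_Q$ is given in each case. - $\tilde{\mathbb{A}}_n$, $n\geq 0$: a cycle with $n+1$ vertices and $n+1$ edges (for $n=0$ one vertex with one loop; for $n=1$ two vertices joined by two edges); $\mathbf{h}_Q=1$ at every vertex. - $\tilde{\mathbb{D}}_n$, $n\geq 4$ ($n+1$ vertices): a path $c_1 - \cdots - c_{n-3}$, with two further vertices attached by an edge to $c_1$ and two further vertices attached by an edge to $c_{n-3}$ (for $n=4$ all four attached to the single vertex $c_1$); $\mathbf{h}_Q=2$ at each $c_i$ and $1$ at the four further vertices. - $\tilde{\mathbb{E}}_6$: a star with a central vertex and three arms with $2$ vertices each; $\mathbf{h}_Q=3$ at the center and $2,1$ along each arm, going outward. - $\tilde{\mathbb{E}}_7$: a star with a central vertex and three arms with $3,3,1$ vertices; $\mathbf{h}_Q=4$ at the center, $3,2,1$ outward along each of the two long arms, and $2$ on the short arm. - $\tilde{\mathbb{E}}_8$: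 a star with a central vertex and three arms with $5,2,1$ vertices; $\mathbf{h}_Q=6$ at the center, $5,4,3,2,1$ outward along the arm with $5$ vertices, $4,2$ outward along the arm with $2$ vertices, and $3$ on the arm with $1$ vertex. *)

(* Defs.v *)
From mathcomp Require Import all_boot all_order all_algebra.
From mathcomp Require Import boolp classical_sets functions cardinality.

Set Implicit Arguments.
Unset Strict Implicit.
Unset Printing Implicit Defensive.

Import GRing.Theory.
Local Open Scope ring_scope.

Record quiver := Quiver {
  vertex : finType;
  arrow : finType;
  src : arrow -> vertex;
  tgt : arrow -> vertex }.

Record quiver_setting := QuiverSetting {
  qs_quiver :> quiver;
  qs_dim : vertex qs_quiver -> nat }.

(* A linear map k^m -> k^n is its n x m matrix, acting on column vectors. *)
Definition representation (k : fieldType) (S : quiver_setting) : Type :=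
  forall a : arrow S, 'M[k]_(qs_dim (tgt a), qs_dim (src a)).

Definition rep_iso (k : fieldType) (S : quiver_setting)
    (M N : representation k S) : Prop :=
  exists g : forall x : vertex S, 'M[k]_(qs_dim x),
    (forall x, g x \in unitmx) /\
    (forall a, N a = g (tgt a) *m M a *m invmx (g (src a))).

Definition iso_class (k : fieldType) (S : quiver_setting)
    (M : representation k S) : set (representation k S) :=
  [set N | rep_iso M N]%classic.

Definition rep_finite (k : fieldType) (S : quiver_setting) : Prop :=
  finite_set (range (@iso_class k S)).

Definition rep_infinite (k : fieldType) (S : quiver_setting) : Prop :=
  ~ rep_finite k S.

Definition quiver_morphism (Q Q' : quiver)
    (f0 : vertex Q -> vertex Q') (f1 : arrow Q -> arrow Q') : Prop :=
  forall a, src (f1 a) = f0 (src a) /\ tgt (f1 a) = f0 (tgt a).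

Definition qs_le (S S' : quiver_setting) : Prop :=
  exists (f0 : vertex S -> vertex S') (f1 : arrow S -> arrow S'),
    [/\ quiver_morphism f0 f1, injective f0, injective f1 &
        forall x, (qs_dim x <= qs_dim (f0 x))%N].

Definition minimal_rep_infinite (k : fieldType) (S : quiver_setting) : Prop :=
  rep_infinite k S /\
  forall S', rep_infinite k S' -> qs_le S' S -> qs_le S S'.

(* The set of endpoints of an edge is a singleton exactly for a loop. *)
Record multigraph := Multigraph {
  gvertex : finType;
  gedge : finType;
  ends : gedge -> {set gvertex} }.

Definition underlying_graph (Q : quiver) : multigraph :=
  @Multigraph (vertex Q) (arrow Q) (fun a => [set src a; tgt a]).

Definition graph_iso (G H : multigraph)
    (fV : gvertex G -> gvertex H) (fE : gedge G -> gedge H) : Prop :=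
  [/\ bijective fV, bijective fE & forall e, ends (fE e) = fV @: ends e].

(* Edge i joins i and i + 1 modulo n.+1. *)
Definition cycle_graph (n : nat) : multigraph :=
  @Multigraph 'I_n.+1 'I_n.+1 (fun i => [set i; ordS i]).

(* Type D~_(m+4): [inl i] is the path vertex c_(i+1), for 0 <= i <= m;         *)
(* [inr (e, b)], for b : bool, are the two further vertices attached to the   *)
(* first (e = false) or last (e = true) path vertex.                          *)
Definition fork_graph (m : nat) : multigraph :=
  @Multigraph ('I_m.+1 + bool * bool)%type ('I_m + bool * bool)%type
    (fun e => match e with
     | inl i => [set inl (widen_ord (leqnSn m) i); inl (lift ord0 i)]
     | inr (e, b) => [set inl (if e then ord_max else ord0); inr (e, b)]
     end).

(* The tree rooted at 0 in which the parent of i + 1 is the i-th entry of p;  *)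
(* each entry of p must be at most its own index.                             *)
Definition tree_graph (p : seq nat) : multigraph :=
  @Multigraph 'I_(size p).+1 'I_(size p)
    (fun i => [set inord (nth 0%N p i); lift ord0 i]).

Inductive euclidean_type :=
  | EuclA of nat    (* EuclA n is A~_n *)
  | EuclD of nat    (* EuclD m is D~_(m+4) *)
  | EuclE6
  | EuclE7
  | EuclE8.

(* In types E the root 0 is the center, and the arms are numbered one after   *)
(* the other, each of them going outward.                                     *)
Definition euclidean_graph (T : euclidean_type) : multigraph :=
  match T with
  | EuclA n => cycle_graph n
  | EuclD m => fork_graph m
  | EuclE6 => tree_graph [:: 0; 1; 0; 3; 0; 5]%N
  | EuclE7 => tree_graph [:: 0; 1; 2; 0; 4; 5; 0]%N
  | EuclE8 => tree_graph [:: 0; 1; 2; 3; 4; 0; 6; 0]%N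
  end.

Definition euclidean_vector (T : euclidean_type) :
    gvertex (euclidean_graph T) -> nat :=
  match T with
  | EuclA n => fun=> 1%N
  | EuclD m => fun x => if x is inl _ then 2%N else 1%N
  | EuclE6 => fun x => nth 0%N [:: 3; 2; 1; 2; 1; 2; 1]%N x
  | EuclE7 => fun x => nth 0%N [:: 4; 3; 2; 1; 3; 2; 1; 2]%N x
  | EuclE8 => fun x => nth 0%N [:: 6; 5; 4; 3; 2; 1; 4; 2; 3]%N x
  end.

(* S is (Q, h_Q) for a Euclidean quiver Q: h_Q is the vector of the type of Q *)
(* transported along an isomorphism of underlying graphs; it does not depend  *)
(* on the choice of the isomorphism.                                          *)
Definition euclidean_setting (S : quiver_setting) : Prop :=
  exists (T : euclidean_type)
         (fV : vertex S -> gvertex (euclidean_graph T))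
         (fE : arrow S -> gedge (euclidean_graph T)),
    @graph_iso (underlying_graph S) (euclidean_graph T) fV fE /\
    forall x, qs_dim x = euclidean_vector (fV x).

(* Main.v *)
Require Import Defs.
From HB Require Import structures.
From mathcomp Require Import all_boot all_order all_algebra.
From mathcomp Require Import boolp classical_sets functions cardinality.
From mathcomp Require Import zify ring.

(** For a dimension vector d, let dim_group d be the dimension of the product of
    the GL(d x) and dim_rep d that of the space of representations; their
    difference is the Tits form q(d).  It mediates between representation
    infinite and Euclidean settings: Euclidean settings have q = 0 and so are
    representation infinite; conversely, if (Q, d) is representation infinite,
    then q(d') <= 0 for some nonzero d' <= d, and (Q, d') lies above a Euclidean
    setting.

    - If q(d) <= 0 with d nonzero, there are infinitely many orbits
      (rep_infinite_of_nonpositive).  Scalars act trivially, so every orbit is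
      the image of finitely many rational maps in dim_group d - 1 < dim_rep d
      variables, and finitely many such images lie in the zero set of one
      nonzero polynomial (avoid_images, by counting monomials).  Euclidean
      vectors have q = 0 because they are harmonic: twice the value at a vertex
      is the sum of the values at its neighbors.

    - If q(d') > 0 for all nonzero d' <= d, there are finitely many orbits
      (finitely_many_of_positive).  Ringel's argument (nonrigid_of_nonbrick,
      indecomposable_rigid) shows that every indecomposable M with dimension
      vector below d is a brick with Ext(M, M) = 0.  Two such representations M
      and N of the same dimension vector are isomorphic (rigid_isomorphic): both
      orbits are open, and concretely almost every point of the line through M
      and N is isomorphic to both.  So there is at most one indecomposable for
      each dimension vector, and representations are biproducts of
      indecomposables.

    - If q(d) <= 0, take a minimal nonzero d with this property
      (contains_euclidean_of_nonpositive).  Loops, parallel arrows and cycles in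
      its support give type A~.  Otherwise the support is a forest, on which d is
      subharmonic, that is, 2 d(x) is at most the sum of the values at the
      neighbors of x, and d(x) = 1 only at leaves, since cutting at another such
      vertex would split q(d).  Following walks outward from a branch vertex
      yields a second branch vertex, hence type D~, or three arms ending in
      leaves, along which d is convex; the inequality at the center then leaves
      only vectors above those of E~6, E~7, E~8.

    Finally, Euclidean settings are pairwise incomparable up to equivalence
    (euclidean_antichain): if E <= S, pairing the harmonic vector of S with the
    image of the vector of E forces the latter to be harmonic on S as well, so
    its difference with the vector of S is a nonnegative harmonic vector with a
    zero, hence vanishes.  Thus a Euclidean setting is minimal, and a minimal
    setting is equivalent to, and so isomorphic to, the Euclidean setting below
    it. *)

Set Implicit Arguments.
Unset Strict Implicit.
Unset Printing Implicit Defensive.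

Import GRing.Theory.
Local Open Scope ring_scope.

(** * Choice and minimality *)

Lemma nat_minimal (P : nat -> Prop) :
  (exists n, P n) -> exists n, P n /\ forall m, P m -> (n <= m)%N.
Proof.
move=> exP; have exQ : exists n, `[< P n >] by case: exP => n Pn; exists n; apply/asboolP.
case: (ex_minnP exQ) => n /asboolP Pn minn; exists n; split=> // m /asboolP; exact: minn.
Qed.

Lemma family_choice (I : Type) (T : I -> Type) (P : forall i, T i -> Prop) :
  (forall i, exists t, P i t) -> exists f : forall i, T i, forall i, P i (f i).
Proof. by move=> exP; exists (fun i => sval (cid (exP i))) => i; case: cid. Qed.

(** * Full-rank factorizations of matrices *)

Section MatrixFactorization.
Variable k : fieldType.

(** A factorization through a space of dimension the rank; carrying the
    one-sided inverses l and q makes c and p cancellable. *)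
Definition factorization m n (A : 'M[k]_(m, n)) r
    (c : 'M_(m, r)) (p : 'M_(r, n)) (l : 'M_(r, m)) (q : 'M_(n, r)) : Prop :=
  [/\ A = c *m p, l *m c = 1%:M & p *m q = 1%:M].

Lemma rank_factorization m n (A : 'M[k]_(m, n)) :
  exists (c : 'M_(m, \rank A)) (p : 'M_(\rank A, n)) l q, factorization A c p l q.
Proof.
have /row_fullP[l lE] := col_base_full A.
have /row_freeP[q qE] := row_base_free A.
by exists (col_base A), (row_base A), l, q; split; rewrite ?mulmx_base.
Qed.

Lemma rank_factorization_fam (I : Type) (m n : I -> nat)
    (A : forall i, 'M[k]_(m i, n i)) :
  exists (c : forall i, 'M_(m i, \rank (A i))) (p : forall i, 'M_(\rank (A i), n i)) l q,
    forall i, factorization (A i) (c i) (p i) (l i) (q i).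
Proof.
have /family_choice[c] := fun i => rank_factorization (A i).
move=> /family_choice[p] /family_choice[l] /family_choice[q] H.
by exists c, p, l, q.
Qed.

Lemma idempotent_factorization n (e : 'M[k]_n) r c p l q :
  @factorization n n e r c p l q -> e *m e = e -> p *m c = 1%:M.
Proof.
move=> [-> lE qE] ee.
have := congr1 (fun X => l *m X *m q) ee.
by rewrite !mulmxA lE !mul1mx -!mulmxA qE mulmx1.
Qed.

Lemma mulmx_rcancel m n r (p : 'M[k]_(r, n)) (q : 'M_(n, r)) (A B : 'M_(m, r)) :
  p *m q = 1%:M -> A *m p = B *m p -> A = B.
Proof. by move=> pq E; rewrite -[A]mulmx1 -pq mulmxA E -mulmxA pq mulmx1. Qed.

Lemma mulmx_lcancel m n r (c : 'M[k]_(n, r)) (l : 'M_(r, n)) (A B : 'M_(r, m)) :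
  l *m c = 1%:M -> c *m A = c *m B -> A = B.
Proof. by move=> lc E; rewrite -[A]mul1mx -lc -mulmxA E mulmxA lc mul1mx. Qed.

Lemma idempotent_complement n (e : 'M[k]_n) :
  e *m e = e -> (1%:M - e) *m (1%:M - e) = 1%:M - e.
Proof. by move=> ee; rewrite mulmxBl mul1mx mulmxBr mulmx1 ee subrr subr0. Qed.

Lemma unitmx_rank_factor n m (A : 'M[k]_(n, m)) (B : 'M[k]_(m, n)) :
  A *m B = 1%:M -> (n <= m)%N.
Proof.
move=> AB; rewrite -(mxrank1 k n) -AB; exact: leq_trans (mxrankM_maxl _ _) (rank_leq_col _).
Qed.

End MatrixFactorization.

(** * Representations, homomorphisms and extensions *)

Section Representations.
Variables (k : fieldType) (Q : quiver).

Definition dimvec := vertex Q -> nat.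
Definition rep (d : dimvec) := forall a : arrow Q, 'M[k]_(d (tgt a), d (src a)).
Definition vmap (d e : dimvec) := forall x : vertex Q, 'M[k]_(e x, d x).
Definition amap (d e : dimvec) := forall a : arrow Q, 'M[k]_(e (tgt a), d (src a)).

Definition rep_hom d e (M : rep d) (N : rep e) (f : vmap d e) : Prop :=
  forall a, f (tgt a) *m M a = N a *m f (src a).

Definition total_dim (d : dimvec) : nat := \sum_x d x.

(** The kernel of the coboundary is Hom(M, N) and its cokernel is Ext(M, N):
    this is the standard resolution over the path algebra. *)
Definition coboundary d e (M : rep d) (N : rep e) (f : vmap d e) : amap d e :=
  fun a => f (tgt a) *m M a - N a *m f (src a).

Definition ext_zero d e (M : rep d) (N : rep e) : Prop :=
  forall h : amap d e, exists f : vmap d e, forall a, coboundary M N f a = h a.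

(** Stated with idempotents, so that summands need not be constructed; the zero
    representation satisfies it too. *)
Definition indecomposable d (M : rep d) : Prop :=
  forall e : vmap d d, rep_hom M M e -> (forall x, e x *m e x = e x) ->
    (forall x, e x = 0) \/ (forall x, e x = 1%:M).

Definition brick d (M : rep d) : Prop :=
  forall f : vmap d d, rep_hom M M f ->
    (forall x, f x = 0) \/ (forall x, f x \in unitmx).

Lemma rep_hom_comp d e c (M : rep d) (N : rep e) (P : rep c) f g :
  rep_hom M N f -> rep_hom N P g -> rep_hom M P (fun x => g x *m f x).
Proof. by move=> Hf Hg a; rewrite -mulmxA Hf mulmxA Hg mulmxA. Qed.

Lemma rep_hom_inv d (M : rep d) f : rep_hom M M f -> (forall x, f x \in unitmx) ->
  rep_hom M M (fun x => invmx (f x)).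
Proof.
move=> Hf uf a; apply: (canRL (mulmxK (uf _))); rewrite -mulmxA.
by apply: (canLR (mulKmx (uf _))); rewrite Hf.
Qed.

Lemma rep_hom1B d (M : rep d) f : rep_hom M M f ->
  rep_hom M M (fun x => 1%:M - f x).
Proof. by move=> Hf a; rewrite mulmxBl mulmxBr mul1mx mulmx1 Hf. Qed.

Definition im_dim d e (f : vmap d e) : dimvec := fun x => \rank (f x).

(** The vertexwise images of f form a representation through which f factors. *)
Lemma rep_image d e (M : rep d) (N : rep e) (f : vmap d e) : rep_hom M N f ->
  exists (I : rep (im_dim f)) c p l q,
    [/\ rep_hom M I p, rep_hom I N c & forall x, factorization (f x) (c x) (p x) (l x) (q x)].
Proof.
move=> Hf; have [c [p [l [q F]]]] := rank_factorization_fam f.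
pose I : rep (im_dim f) := fun a => l (tgt a) *m N a *m c (src a).
have HI : rep_hom M I p.
  move=> a; have [fs ls qs] := F (src a); have [ft lt qt] := F (tgt a).
  by rewrite /I -!mulmxA -fs -Hf ft !mulmxA lt mul1mx.
exists I, c, p, l, q; split=> // a.
have [fs ls qs] := F (src a); have [ft lt qt] := F (tgt a).
by apply: (mulmx_rcancel qs); rewrite -mulmxA -HI mulmxA -ft Hf -mulmxA -fs.
Qed.

(** Path algebras are hereditary: Ext(-, N) turns monomorphisms into
    epimorphisms.  Here the extension of a cocycle along u is explicit, by means
    of vertexwise left inverses. *)
Lemma ext_zero_mono d e c (I : rep d) (K : rep e) (N : rep c) u (l : vmap e d) :
  rep_hom I K u -> (forall x, l x *m u x = 1%:M) -> ext_zero K N -> ext_zero I N.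
Proof.
move=> Hu lu extK h.
have [f fE] := extK (fun a => h a *m l (src a)).
exists (fun x => f x *m u x) => a.
rewrite /coboundary -mulmxA Hu !mulmxA -mulmxBl.
by have := fE a; rewrite /coboundary => ->; rewrite -mulmxA lu mulmx1.
Qed.

(** The connecting map of 0 -> K -> M -> I -> 0: a vertexwise extension of g has a
    coboundary vanishing on K, that is, a cocycle on I, and Ext(I, N) = 0 allows
    to correct the extension by a map factoring through p. *)
Lemma extend_along_kernel d dI dK c (M : rep d) (I : rep dI) (K : rep dK) (N : rep c)
  (p : vmap d dI) (r : vmap dI d) (i : vmap dK d) (l : vmap d dK) (g : vmap dK c) :
  rep_hom M I p -> rep_hom K M i -> rep_hom K N g ->
  (forall x, p x *m r x = 1%:M) -> (forall x, l x *m i x = 1%:M) ->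
  (forall x, p x *m i x = 0) -> (forall x, i x *m l x + r x *m p x = 1%:M) ->
  ext_zero I N ->
  exists h : vmap d c, rep_hom M N h /\ forall x, h x *m i x = g x.
Proof.
move=> Hp Hi Hg pr li pi0 split1 ext.
have [g' g'i] : exists g' : vmap d c, forall x, g' x *m i x = g x.
  by exists (fun x => g x *m l x) => x; rewrite -mulmxA li mulmx1.
pose h' := coboundary M N g'.
have h'i a : h' a *m i (src a) = 0.
  rewrite /h' /coboundary mulmxBl -!mulmxA -Hi g'i !mulmxA g'i.
  by rewrite Hg subrr.
have h'E a : h' a = h' a *m r (src a) *m p (src a).
  by rewrite -[LHS]mulmx1 -(split1 (src a)) mulmxDr mulmxA h'i mul0mx add0r mulmxA.
have [f fE] := ext (fun a => h' a *m r (src a)).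
exists (fun x => g' x - f x *m p x); split; last first.
  by move=> x; rewrite mulmxBl g'i -mulmxA pi0 mulmx0 subr0.
move=> a; apply/eqP; rewrite -subr_eq0; apply/eqP.
have := fE a; rewrite /coboundary => E.
have -> : (g' (tgt a) - f (tgt a) *m p (tgt a)) *m M a -
   N a *m (g' (src a) - f (src a) *m p (src a)) =
   h' a - (f (tgt a) *m I a - N a *m f (src a)) *m p (src a).
  rewrite /h' /coboundary !mulmxBl !mulmxBr -!mulmxA Hp.
  by rewrite opprD addrACA -opprD.
by rewrite E -h'E subrr.
Qed.

(** The kernel of a vertexwise split p is the image of the idempotent 1 - r p. *)
Lemma rep_kernel d dI (M : rep d) (I : rep dI) (p : vmap d dI) (r : vmap dI d) :
  rep_hom M I p -> (forall x, p x *m r x = 1%:M) ->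
  exists (dK : dimvec) (K : rep dK) (i : vmap dK d) (l : vmap d dK),
   [/\ rep_hom K M i, (forall x, l x *m i x = 1%:M), (forall x, p x *m i x = 0)
     & (forall x, i x *m l x + r x *m p x = 1%:M)].
Proof.
move=> Hp pr.
pose e : vmap d d := fun x => 1%:M - r x *m p x.
have ee x : e x *m e x = e x.
  by apply: idempotent_complement; rewrite mulmxA -[_ *m r x]mulmxA pr mulmx1.
have [i [l [l2 [q F]]]] := rank_factorization_fam e.
have il x : i x *m l x = e x by case: (F x).
have li x : l x *m i x = 1%:M by apply: (idempotent_factorization (F x)).
have pi0 x : p x *m i x = 0.
  rewrite -[i x]mulmx1 -(li x) [i x *m _]mulmxA il mulmxA /e mulmxBr mulmx1 mulmxA pr mul1mx.
  by rewrite subrr mul0mx.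
exists (im_dim e), (fun a => l (tgt a) *m M a *m i (src a)), i, l; split=> //; last first.
  by move=> x; rewrite il subrK.
move=> a; rewrite !mulmxA il /e !mulmxBl mul1mx -[_ *m _ *m M a]mulmxA Hp.
by rewrite -!mulmxA pi0 !mulmx0 subr0.
Qed.

End Representations.

(** * Ringel's lemma *)

Section Ringel.
Variables (k : fieldType) (Q : quiver).
Notation dimvec := (dimvec Q).
Notation rep := (@rep k Q).
Notation vmap := (@vmap k Q).

Lemma total_dim_leq_eq (d e : dimvec) : (forall x, (e x <= d x)%N) ->
  (total_dim d <= total_dim e)%N -> forall x, e x = d x.
Proof.
move=> le_ed le_tot x; apply/eqP; rewrite eqn_leq le_ed /=.
rewrite leqNgt; apply/negP => lt_ed; move: le_tot; rewrite leqNgt => /negP; apply.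
rewrite /total_dim (bigD1 x) //= [X in (_ < X)%N](bigD1 x) //=.
by rewrite -addSn leq_add // leq_sum.
Qed.

Lemma unitmx_rank n (A : 'M[k]_n) : (n <= \rank A)%N -> A \in unitmx.
Proof. by move=> h; rewrite -row_free_unit /row_free eqn_leq h rank_leq_row. Qed.

(** An indecomposable that is not a brick contains a smaller indecomposable with
    self-extensions: a summand of the kernel of a square-zero endomorphism t that
    the image of t meets nontrivially. *)
Lemma nonrigid_of_nonbrick d (M : rep d) : indecomposable M -> ~ brick M ->
  exists e (K : rep e), [/\ forall x, (e x <= d x)%N, (total_dim e < total_dim d)%N,
    indecomposable K & ~ ext_zero K K].
Proof.
move=> indM nbrick.
pose P n := exists f : vmap d d, [/\ rep_hom M M f, ~ (forall x, f x = 0),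
  ~ (forall x, f x \in unitmx) & total_dim (im_dim f) = n].
have [n [[t [Ht t_neq0 t_nunit tn]] tmin]] : exists n, P n /\ forall m, P m -> (n <= m)%N.
  apply: nat_minimal; apply: contrapT => nP; apply: nbrick => f Hf.
  apply: contrapT => /not_orP[f0 fu]; apply: nP.
  by exists (total_dim (im_dim f)), f.
have [I [c [p [l [q [Hp Hc F]]]]]] := rep_image Ht.
have tE x : t x = c x *m p x by case: (F x).
have lc x : l x *m c x = 1%:M by case: (F x).
have pq x : p x *m q x = 1%:M by case: (F x).
(* Otherwise t^2 has the same rank as t, so p c is an automorphism of the image
   of t, and c (p c)^-1 p is an idempotent different from 0 and 1. *)
have pc0 x : p x *m c x = 0.
  have [z|nz] := pselect (forall x, t x *m t x = 0).
    have := z x; rewrite !tE => /(congr1 (fun X => l x *m X *m q x)).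
    by rewrite !mulmxA lc mul1mx -!mulmxA pq mulmx1 mul0mx mulmx0.
  exfalso.
  have rk y : \rank (t y *m t y) = im_dim t y.
    apply: (@total_dim_leq_eq (im_dim t) (im_dim (fun y => t y *m t y))) => [z|].
      exact: mxrankM_maxl.
    rewrite tn; apply: tmin; exists (fun y => t y *m t y); split=> //.
      exact: (rep_hom_comp Ht Ht).
    by move=> U; apply: t_nunit => z; have := U z; rewrite unitmx_mul => /andP[].
  have uu y : p y *m c y \in unitmx.
    have tt : t y *m t y = c y *m (p y *m c y) *m p y.
      by rewrite mulmxA -tE -mulmxA -tE.
    apply: unitmx_rank; apply: (@leq_trans (\rank (t y *m t y))); first by rewrite rk.
    rewrite tt; apply: leq_trans (mxrankM_maxl _ _) (mxrankM_maxr _ _).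
  have Hu := rep_hom_comp Hc Hp; have Hui := rep_hom_inv Hu uu.
  have He := rep_hom_comp (rep_hom_comp Hp Hui) Hc.
  case: (indM _ He) => [y|e0|e1].
  - rewrite -!mulmxA; congr (_ *m _).
    by rewrite [p y *m (c y *m _)]mulmxA mulKmx ?uu.
  - apply: t_neq0 => y; rewrite tE.
    have : invmx (p y *m c y) = 0.
      have := e0 y => /(congr1 (fun X => l y *m X *m q y)).
      by rewrite !mulmxA lc mul1mx -!mulmxA pq mulmx1 mul0mx mulmx0.
    move=> z; have := mulmxV (uu y); rewrite z mulmx0 => o.
    by rewrite -[p y]mul1mx -o mul0mx mulmx0.
  - apply: t_nunit => y; apply: unitmx_rank.
    exact: (unitmx_rank_factor (e1 y)).
(* As t^2 = 0, the image of t is contained in its kernel K, by the inclusion j. *)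
have [dK [K [i [s [Hi si pi0 sp1]]]]] := rep_kernel Hp pq.
pose j0 x := s x *m c x.
have [j ijc] : exists j : vmap (im_dim t) dK, forall x, i x *m j x = c x.
  exists j0 => x; rewrite /j0 mulmxA -[i x *m s x](addrK (q x *m p x)) sp1.
  by rewrite mulmxBl mul1mx -mulmxA pc0 mulmx0 subr0.
have Hj : rep_hom I K j.
  move=> a; apply: (mulmx_lcancel (si (tgt a))).
  by rewrite !mulmxA Hi ijc -[RHS]mulmxA ijc Hc.
(* K' is a smallest summand of K on which the image of t projects nontrivially. *)
pose S n := exists e (K' : rep e) (g : vmap e dK) (h : vmap dK e),
  [/\ rep_hom K' K g, rep_hom K K' h, (forall x, h x *m g x = 1%:M),
   ~ (forall x, h x *m j x = 0) & total_dim e = n].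
have [m [[e [K' [g [h [Hg Hh hg hj0 em]]]]] Smin]] :
    exists n, S n /\ forall m, S m -> (n <= m)%N.
  apply: nat_minimal; exists (total_dim dK), dK, K, (fun=> 1%:M), (fun=> 1%:M).
  split=> // [a|a|x|]; rewrite ?mul1mx ?mulmx1 //.
  move=> j0'; apply: t_neq0 => x; rewrite tE -ijc.
  by have := j0' x; rewrite mul1mx => ->; rewrite mulmx0 mul0mx.
have [u uE] : exists u : vmap (im_dim t) e, forall x, u x = h x *m j x.
  by exists (fun x => h x *m j x).
have Hu : rep_hom I K' u by move=> a; rewrite !uE; exact: (rep_hom_comp Hj Hh a).
have u0 : ~ (forall x, u x = 0) by move=> z; apply: hj0 => x; rewrite -uE.
(* The image of an idempotent f of K' is a summand of K competing with K'. *)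
have idem1 (f : vmap e e) : rep_hom K' K' f -> (forall x, f x *m f x = f x) ->
    ~ (forall x, f x *m u x = 0) -> forall x, f x = 1%:M.
  move=> Hf ff fu x.
  have [A [c' [p' [l' [q' [Hp' Hc' F']]]]]] := rep_image Hf.
  have pc' y : p' y *m c' y = 1%:M := idempotent_factorization (F' y) (ff y).
  have le_rk y : (im_dim f y <= e y)%N by exact: rank_leq_row.
  have rk : im_dim f x = e x.
    apply: (@total_dim_leq_eq e) => //; rewrite em; apply: Smin.
    exists (im_dim f), A, (fun y => g y *m c' y), (fun y => p' y *m h y); split=> //.
    - exact: (rep_hom_comp Hc' Hg).
    - exact: (rep_hom_comp Hh Hp').
    - by move=> y; rewrite -mulmxA [h y *m _]mulmxA hg mul1mx pc'.
    - move=> z; apply: fu => y; have [-> _ _] := F' y.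
      by rewrite uE -mulmxA [p' y *m _]mulmxA z mulmx0.
  have uf : f x \in unitmx by apply: unitmx_rank; rewrite -/(im_dim f x) rk.
  by rewrite -[f x](mulKmx uf) ff mulVmx.
have indK' : indecomposable K'.
  move=> f Hf ff; have [fu|fu] := pselect (forall x, f x *m u x = 0); last first.
    by right; exact: idem1.
  left=> x; have H1 := rep_hom1B Hf.
  have /(_ x) E : forall x, 1%:M - f x = 1%:M.
    apply: (idem1 (fun y => 1%:M - f y)) => // [y|z]; first exact: idempotent_complement.
    by apply: u0 => y; have := z y; rewrite mulmxBl mul1mx fu subr0.
  by rewrite -[f x](subKr 1%:M) E subrr.
(* The endomorphism M -> I -> K' -> K -> M has rank at least that of t. *)
have u_inj : exists v : vmap e (im_dim t), forall x, v x *m u x = 1%:M.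
  apply: (@family_choice _ _ (fun x (v : 'M_(im_dim t x, e x)) => v *m u x = 1%:M)) => x.
  apply/row_fullP; rewrite /row_full eqn_leq rank_leq_col /=.
  pose t' y := i y *m (g y *m (u y *m p y)).
  have rk_tu y : (\rank (t' y) <= \rank (u y))%N.
    rewrite /t' mulmxA; apply: leq_trans (mxrankM_maxr _ _) _; exact: mxrankM_maxl.
  suff tx : im_dim t' x = im_dim t x by apply: leq_trans (rk_tu x); rewrite -/(im_dim t' x) tx.
  have le_t' y : (im_dim t' y <= im_dim t y)%N.
    by apply: leq_trans (rk_tu y) _; exact: rank_leq_col.
  apply: (@total_dim_leq_eq (im_dim t)) => //; rewrite tn; apply: tmin; exists t'; split=> //.
  - have H1 := rep_hom_comp Hp Hu; have H2 := rep_hom_comp H1 Hg.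
    exact: (rep_hom_comp H2 Hi).
  - move=> z; apply: u0 => y; have := z y.
    move=> /(congr1 (fun X => h y *m (s y *m X) *m q y)) /=.
    rewrite /t' [s y *m (i y *m _)]mulmxA si mul1mx [h y *m (g y *m _)]mulmxA hg mul1mx.
    by rewrite -mulmxA pq mulmx1 !mulmx0 mul0mx.
  - move=> U; apply: t_nunit => y; apply: unitmx_rank.
    by apply: leq_trans (le_t' y); rewrite /im_dim (mxrank_unit (U y)).
have le_dK x : (dK x <= d x)%N by exact: unitmx_rank_factor (si x).
exists e, K'; split=> //.
- by move=> x; apply: leq_trans (le_dK x); exact: unitmx_rank_factor (hg x).
- apply: (@leq_ltn_trans (total_dim dK)).
    by apply: leq_sum => x _; exact: unitmx_rank_factor (hg x).
  rewrite ltnNge; apply/negP => /(total_dim_leq_eq le_dK) eq_dK; apply: t_neq0 => x.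
  have /row_freeP[b ib] : row_free (i x).
    rewrite /row_free eqn_leq rank_leq_row /= -{1}(eq_dK x) -[X in (X <= _)%N](mxrank1 k).
    by rewrite -(si x) mxrankM_maxr.
  by rewrite tE -[p x]mulmx1 -ib [p x *m _]mulmxA pi0 mul0mx mulmx0.
(* If Ext(K', K') = 0, the projection of K onto K' extends to M, and K' becomes a
   summand of M that t kills. *)
move=> extK'; have [v vu] := u_inj.
have extI := ext_zero_mono Hu vu extK'.
have [w [Hw wi]] := extend_along_kernel Hp Hi Hh pq si pi0 sp1 extI.
pose r x := i x *m (g x *m w x).
have Hr : rep_hom M M r by exact: rep_hom_comp (rep_hom_comp Hw Hg) Hi.
have wr x : w x *m r x = w x by rewrite /r !mulmxA wi hg mul1mx.
have rr x : r x *m r x = r x by rewrite {1 3}/r -!mulmxA wr.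
case: (indM r Hr rr) => r01.
- apply: u0 => x; have := wr x; rewrite r01 mulmx0 => w0.
  by rewrite -[u x]mul1mx -(hg x) -wi -w0 !mul0mx.
- apply: t_neq0 => x; rewrite tE -[p x]mulmx1 -(r01 x) /r.
  by rewrite [p x *m (_ *m _)]mulmxA pi0 mul0mx mulmx0.
Qed.

End Ringel.

(** * Coordinates on families of matrices *)

Section Flattening.
Variables (I : finType) (m n : I -> nat).

Definition entry := {i : I & ('I_(m i) * 'I_(n i))%type}.

Lemma card_entry : #|{: entry}| = (\sum_i m i * n i)%N.
Proof.
rewrite card_tagged sumnE big_map big_enum /=.
by apply: eq_bigr => i _; rewrite card_prod !card_ord.
Qed.

Variable k : fieldType.

Definition flat (F : forall i, 'M[k]_(m i, n i)) : 'rV[k]_#|{: entry}| :=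
  \row_j F (tag (enum_val j)) (tagged (enum_val j)).1 (tagged (enum_val j)).2.

Definition unflat (v : 'rV[k]_#|{: entry}|) (i : I) : 'M[k]_(m i, n i) :=
  \matrix_(a, b) v 0 (enum_rank (Tagged (fun i => ('I_(m i) * 'I_(n i))%type) (a, b))).

Lemma flatK F i : unflat (flat F) i = F i.
Proof. by apply/matrixP => a b; rewrite !mxE enum_rankK. Qed.

Lemma unflatK v : flat (unflat v) = v.
Proof.
apply/rowP => j; rewrite !mxE; congr (v 0 _); apply: (canLR enum_valK).
by case: (enum_val j) => i [a b].
Qed.

Lemma unflat_linear c u v i : unflat (c *: u + v) i = c *: unflat u i + unflat v i.
Proof. by apply/matrixP => a b; rewrite !mxE. Qed.

Lemma flat_linear c F G :
  flat (fun i => c *: F i + G i) = c *: flat F + flat G.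
Proof. by apply/rowP => j; rewrite !mxE. Qed.

Lemma unflat_mulmx r (v : 'rV[k]_r) (Z : 'I_r -> forall i, 'M[k]_(m i, n i)) i :
  unflat (v *m \matrix_j flat (Z j)) i = \sum_j v 0 j *: Z j i.
Proof.
apply/matrixP => a b; rewrite !mxE summxE; apply: eq_bigr => j _.
by rewrite !mxE enum_rankK.
Qed.

End Flattening.

Lemma linear_rV_mx (k : fieldType) m n (f : 'rV[k]_m -> 'rV[k]_n) :
  (forall a u v, f (a *: u + v) = a *: f u + f v) ->
  exists A, forall v, f v = v *m A.
Proof.
move=> lin_f.
pose L := HB.pack_for {linear 'rV[k]_m -> 'rV[k]_n} f
  (GRing.isLinear.Build _ _ _ _ f lin_f).
by exists (lin1_mx L) => v; rewrite mul_rV_lin1.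
Qed.

(** Endomorphisms have eigenvalues, k being algebraically closed. *)
Lemma exists_singular_shift (k : closedFieldType) n (A : 'M[k]_n) : (0 < n)%N ->
  exists c, (A - c%:M) \notin unitmx.
Proof.
case: n A => // n A _.
have /closed_rootP[c] : size (char_poly A) != 1%N by rewrite size_char_poly.
rewrite -eigenvalue_root_char => /eigenvalueP[v vA v0]; exists c.
apply: contra v0 => U; rewrite -[v](mulmxK U) mulmxBr vA mul_mx_scalar subrr.
by rewrite mul0mx.
Qed.

(** * Rigid representations and finiteness *)

Section Rigidity.
Variables (k : closedFieldType) (Q : quiver).
Notation dimvec := (dimvec Q).
Notation rep := (@rep k Q).
Notation vmap := (@vmap k Q).
Notation amap := (@amap k Q).

(** The difference dim_group d - dim_rep d is the Tits form of Q at d, equal to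
    dim Hom(M, M) - dim Ext(M, M) for every M of dimension vector d. *)
Definition dim_group (d : dimvec) : nat := \sum_x d x * d x.
Definition dim_rep (d : dimvec) : nat := \sum_a d (tgt a) * d (src a).

Lemma coboundary_linear (d e : dimvec) (M : rep d) (N : rep e) c f g a :
  coboundary M N (fun x => c *: f x + g x) a =
  c *: coboundary M N f a + coboundary M N g a.
Proof.
rewrite /coboundary mulmxDl mulmxDr -scalemxAl -scalemxAr scalerBr.
by rewrite opprD addrACA.
Qed.

Lemma brick_scalar d (M : rep d) : brick M -> (exists x, 0 < d x)%N ->
  forall f, rep_hom M M f -> exists c, forall x, f x = c%:M.
Proof.
move=> brM [x dx] f Hf; have [c fc] := exists_singular_shift (f x) dx.
exists c => y; apply/eqP; rewrite -subr_eq0; apply/eqP; move: y.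
have [|//|U] := brM (fun y => f y - c%:M); last by rewrite U in fc.
by move=> a; rewrite mulmxBl mulmxBr Hf scalar_mxC.
Qed.

(** The coboundary on gl(d) has the scalars as kernel, so its rank is
    dim_group d - 1, which is at least dim_rep d. *)
Lemma brick_rigid d (M : rep d) : brick M -> (exists x, 0 < d x)%N ->
  (dim_rep d < dim_group d)%N -> ext_zero M M.
Proof.
move=> brM d0 q_pos.
pose Phi v := flat (coboundary M M (@unflat _ d d k v)).
have [A PhiE] : exists A, forall v, Phi v = v *m A.
  apply: linear_rV_mx => a u v; rewrite -flat_linear /Phi.
  congr flat; apply: functional_extensionality_dep => b.
  rewrite -coboundary_linear; congr (coboundary _ _ _ b).
  by apply: functional_extensionality_dep => x; rewrite unflat_linear.
have ker_le : (kermx A <= flat (fun x => 1%:M : 'M[k]_(d x)))%MS.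
  apply/row_subP => i; set v := row i _.
  have vA : v *m A = 0 by apply/eqP; rewrite -sub_kermx row_sub.
  have [|c vE] := brick_scalar brM d0 (f := unflat v).
    move=> a; apply/eqP; rewrite -subr_eq0; apply/eqP.
    rewrite -[LHS]/(coboundary M M (unflat v) a) -[LHS](flatK (coboundary M M _)).
    by rewrite -/(Phi v) PhiE vA; apply/matrixP => ? ?; rewrite !mxE.
  suff -> : v = c *: flat (fun x => 1%:M : 'M[k]_(d x)) by exact: scalemx_sub.
  rewrite -[v]unflatK; apply/rowP => j; rewrite !mxE.
  have := congr1 (fun X : 'M[k]_(d (tag (enum_val j))) =>
    X (tagged (enum_val j)).1 (tagged (enum_val j)).2) (vE (tag (enum_val j))).
  by rewrite !mxE mulr_natr => ->.
have rkA : row_full A.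
  have := mxrankS ker_le; rewrite mxrank_ker => rk.
  have := leq_trans rk (rank_leq_row _).
  rewrite /row_full eqn_leq rank_leq_col /= => rk1.
  have h1 := card_entry d d.
  have h2 := card_entry (fun a : arrow Q => d (tgt a)) (fun a => d (src a)).
  move: rk1; rewrite -/(dim_group d) in h1; rewrite -/(dim_rep d) in h2.
  set nG := #|_| in h1 *; set nR := #|_| in h2 *; set rr := mxrank _.
  move: q_pos; rewrite -h1 -h2; lia.
have [B BA] := row_fullP rkA.
move=> h; exists (unflat (flat h *m B)) => a.
rewrite -[LHS](flatK (coboundary M M _)) -[flat _]/(Phi _) PhiE.
by rewrite -mulmxA BA mulmx1 flatK.
Qed.

(** The orbit of a rigid M is open: in any direction X, almost all M + t X lie on
    it.  The open condition is the nonvanishing of a polynomial p in t. *)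
Lemma rigid_generic d (M : rep d) (X : amap d d) : ext_zero M M ->
  exists p : {poly k}, p.[0] = 1 /\ forall t, p.[t] != 0 ->
    exists g : vmap d d, (forall x, g x \in unitmx) /\
      rep_hom M (fun a => M a + t *: X a) g.
Proof.
move=> extM.
set nR := #|{: entry (fun a : arrow Q => d (tgt a)) (fun a => d (src a))}|.
have /family_choice[s sE] := fun j : 'I_nR => extM (unflat (delta_mx 0 j)).
(* Let s be a linear section of g |-> g M - M g and let Y be the linear map
   h |-> X s(h).  For g = c + t s(w), the equation g M = (M + t X) g amounts to
   w (1 - t Y) = c X; Cramer's rule solves it over k[t] with c = det (1 - t Y). *)
pose Y : 'M[k]_nR := \matrix_j flat (fun a => X a *m s j (src a)).
pose Pm : 'M[{poly k}]_nR := 1%:M - 'X *: map_mx polyC Y.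
pose w := map_mx polyC (flat X) *m \adj Pm.
pose G x : 'M[{poly k}]_(d x) :=
  (\det Pm)%:M + 'X *: (\sum_j w 0 j *: map_mx polyC (s j x)).
have evP t : map_mx (horner_eval t) Pm = 1%:M - t *: Y.
  by apply/matrixP => i j; rewrite !mxE /horner_eval !hornerE hornerMn hornerE.
pose p := \prod_x \det (G x).
pose g t x := map_mx (horner_eval t) (G x).
have detg t x : \det (g t x) = (\det (G x)).[t] by rewrite det_map_mx.
have evG t x : g t x = (\det (1%:M - t *: Y))%:M +
    t *: \sum_j (flat X *m \adj (1%:M - t *: Y)) 0 j *: s j x.
  rewrite /g /G map_mxD map_mxZ /= map_scalar_mx /= -det_map_mx evP map_mx_sum.
  congr (_ + _ *: _); first by rewrite /horner_eval hornerX.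
  apply: eq_bigr => j _; rewrite map_mxZ; congr (_ *: _).
    have XE : map_mx (horner_eval t) (map_mx polyC (flat X)) = flat X.
      by apply/rowP => i; rewrite !mxE /horner_eval hornerC.
    by rewrite -evP -map_mx_adj -[in RHS]XE -map_mxM [RHS]mxE.
  by apply/matrixP => a b; rewrite !mxE /= /horner_eval hornerC.
exists p; split.
  rewrite /p horner_prod big1 // => x _.
  by rewrite -detg evG !scale0r subr0 addr0 !det1.
move=> t pt; exists (g t); split.
  move=> x; rewrite unitmxE detg unitfE; apply: contra pt => /eqP z.
  by rewrite /p horner_prod; apply/prodf_eq0; exists x => //; apply/eqP.
move=> a; apply/eqP; rewrite -subr_eq0; apply/eqP; rewrite !evG.
set P := 1%:M - t *: Y; set v := flat X *m \adj P.
have vP : v *m P = \det P *: flat X by rewrite -mulmxA mul_adj_mx mul_mx_scalar.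
have cobE : \sum_j v 0 j *: (s j (tgt a) *m M a - M a *m s j (src a)) = unflat v a.
  transitivity (\sum_j v 0 j *: unflat (delta_mx 0 j : 'rV_nR) a).
    by apply: eq_bigr => j _; rewrite -sE.
  rewrite -(unflat_mulmx v (fun j : 'I_nR => @unflat _ _ _ k (delta_mx 0 j)) a).
  congr (unflat _ a); rewrite -[RHS]mulmx1; congr (_ *m _).
  by apply/matrixP => i j; rewrite mxE unflatK !mxE eqxx eq_sym.
have XE : \sum_j v 0 j *: (X a *m s j (src a)) = unflat (v *m Y) a.
  by rewrite unflat_mulmx.
pose S x := \sum_j v 0 j *: s j x.
have E1 : S (tgt a) *m M a = unflat v a + M a *m S (src a).
  apply/eqP; rewrite -subr_eq -cobE mulmx_suml mulmx_sumr -sumrB; apply/eqP.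
  by apply: eq_bigr => j _; rewrite -scalemxAl -scalemxAr scalerBr.
have E2 : X a *m S (src a) = unflat (v *m Y) a.
  by rewrite -XE mulmx_sumr; apply: eq_bigr => j _; rewrite -scalemxAr.
have E3 : unflat v a = \det P *: X a + t *: unflat (v *m Y) a.
  apply/matrixP => i j; have := congr1 (fun u => unflat u a i j) vP.
  rewrite /P mulmxBr mulmx1 -scalemxAr !mxE !enum_rankK /= => <-.
  by rewrite subrK.
rewrite -!/(S _) mulmxDl mul_scalar_mx -scalemxAl E1 E3.
rewrite mulmxDr !mulmxDl !mul_mx_scalar -!scalemxAr -!scalemxAl E2.
by apply/eqP; rewrite subr_eq0; apply/eqP/matrixP => i j; rewrite !mxE; ring.
Qed.

Definition isomorphic d (M N : rep d) : Prop :=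
  exists g : vmap d d, (forall x, g x \in unitmx) /\ rep_hom M N g.

Lemma isomorphic_sym d (M N : rep d) : isomorphic M N -> isomorphic N M.
Proof.
move=> [g [ug Hg]]; exists (fun x => invmx (g x)); split=> [x|a].
  by rewrite unitmx_inv.
apply: (canRL (mulmxK (ug _))); rewrite -mulmxA.
by apply: (canLR (mulKmx (ug _))); rewrite Hg.
Qed.

Lemma isomorphic_trans d (M N P : rep d) : isomorphic M N -> isomorphic N P -> isomorphic M P.
Proof.
move=> [g [ug Hg]] [h [uh Hh]]; exists (fun x => h x *m g x); split=> [x|].
  by rewrite unitmx_mul uh ug.
exact: rep_hom_comp Hg Hh.
Qed.

(** Almost every point M + t (N - M) = N + (1 - t) (M - N) of the line through M
    and N is isomorphic to both. *)
Lemma rigid_isomorphic d (M N : rep d) : ext_zero M M -> ext_zero N N -> isomorphic M N.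
Proof.
move=> rM rN.
have [p [p0 pP]] := rigid_generic (fun a => N a - M a) rM.
have [q [q0 qP]] := rigid_generic (fun a => M a - N a) rN.
have : p * (q \Po (1 - 'X)) != 0.
  rewrite mulf_neq0 //; apply/eqP.
    by move=> z; move/eqP: p0; rewrite z horner0 eq_sym oner_eq0.
  move=> /(congr1 (fun r => r.[1])); rewrite horner_comp !hornerE subrr q0.
  by move/eqP; rewrite oner_eq0.
move=> /closed_nonrootP[t]; rewrite rootE hornerM horner_comp !hornerE.
rewrite mulf_eq0 negb_or => /andP[pt qt].
have isoM : isomorphic M (fun a => M a + t *: (N a - M a)) by exact: pP.
have isoN : isomorphic N (fun a => N a + (1 - t) *: (M a - N a)) by exact: qP.
apply: isomorphic_trans isoM (isomorphic_sym _).
suff <- : (fun a => N a + (1 - t) *: (M a - N a)) = (fun a => M a + t *: (N a - M a)) by [].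
apply: functional_extensionality_dep => a; apply/matrixP => i j; rewrite !mxE; ring.
Qed.

(** By induction on the total dimension: were M not a brick, it would contain a
    smaller indecomposable which is not rigid. *)
Lemma indecomposable_rigid d (M : rep d) : indecomposable M -> (exists x, 0 < d x)%N ->
  (forall e : dimvec, (forall x, e x <= d x)%N -> (exists x, 0 < e x)%N ->
    (dim_rep e < dim_group e)%N) ->
  ext_zero M M.
Proof.
have [n] := ubnP (total_dim d); elim: n d M => // n IHn d M; rewrite ltnS => le_dn indM d0 q_pos.
have [brM|nbrM] := pselect (brick M).
  by apply: brick_rigid => //; exact: q_pos.
have [e [K [le_ed lt_ed indK next]]] := nonrigid_of_nonbrick indM nbrM.
exfalso; apply: (next); apply: IHn => //; first exact: leq_trans lt_ed le_dn.
  apply: contrapT => /forallNP e0; apply: next => h; exists (fun=> 0) => a.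
  by apply/matrixP => i; case: (e0 (tgt a)); exact: leq_ltn_trans (ltn_ord i).
move=> f le_fe; apply: q_pos => x; exact: leq_trans (le_fe x) (le_ed x).
Qed.

(** A relation rather than an operation: the dimension vector of M is only
    propositionally the sum of those of A and B. *)
Definition biproduct d (M : rep d) dA dB (A : rep dA) (B : rep dB) : Prop :=
  exists (iA : vmap dA d) (pA : vmap d dA) (iB : vmap dB d) (pB : vmap d dB),
    [/\ rep_hom A M iA, rep_hom M A pA, rep_hom B M iB & rep_hom M B pB] /\
    forall x, [/\ pA x *m iA x = 1%:M, pB x *m iB x = 1%:M, pA x *m iB x = 0,
      pB x *m iA x = 0 & iA x *m pA x + iB x *m pB x = 1%:M].

Lemma rep_hom_add d e (M : rep d) (N : rep e) f g :
  rep_hom M N f -> rep_hom M N g -> rep_hom M N (fun x => f x + g x).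
Proof. by move=> Hf Hg a; rewrite mulmxDl mulmxDr Hf Hg. Qed.

Lemma biproduct_isomorphic d (M N : rep d) dA dB (A A' : rep dA) (B B' : rep dB) :
  biproduct M A B -> biproduct N A' B' -> isomorphic A A' -> isomorphic B B' -> isomorphic M N.
Proof.
move=> [iA [pA [iB [pB [[HiA HpA HiB HpB] E]]]]].
move=> [jA [qA [jB [qB [[HjA HqA HjB HqB] E']]]]].
move=> [g [ug Hg]] [h [uh Hh]].
exists (fun x => jA x *m (g x *m pA x) + jB x *m (h x *m pB x)); split.
  move=> x; have [ai bi ab ba s1] := E x; have [ai' bi' ab' ba' s1'] := E' x.
  suff /mulmx1_unit[] : (iA x *m (invmx (g x) *m qA x) + iB x *m (invmx (h x) *m qB x)) *m
    (jA x *m (g x *m pA x) + jB x *m (h x *m pB x)) = 1%:M by [].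
  rewrite mulmxDl !mulmxDr -!mulmxA.
  rewrite [qA x *m (jA x *m _)]mulmxA [qB x *m (jA x *m _)]mulmxA.
  rewrite [qA x *m (jB x *m _)]mulmxA [qB x *m (jB x *m _)]mulmxA.
  rewrite ai' bi' ab' ba' !mul0mx !mulmx0 !mul1mx.
  by rewrite addr0 add0r !mulKmx ?ug ?uh.
by apply: rep_hom_add; [exact: rep_hom_comp (rep_hom_comp HpA Hg) HjA
  | exact: rep_hom_comp (rep_hom_comp HpB Hh) HjB].
Qed.

(** The two parts are the images of e and 1 - e for a nontrivial idempotent e. *)
Lemma decompose d (M : rep d) : ~ indecomposable M ->
  exists dA dB (A : rep dA) (B : rep dB),
    [/\ biproduct M A B, (forall x, dA x <= d x)%N, (forall x, dB x <= d x)%N,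
        (total_dim dA < total_dim d)%N & (total_dim dB < total_dim d)%N].
Proof.
move=> /existsNP[e /not_implyP[He /not_implyP[ee /not_orP[e0 e1]]]].
have Hf := rep_hom1B He; have ff x := idempotent_complement (ee x).
have ef0 x : e x *m (1%:M - e x) = 0 by rewrite mulmxBr mulmx1 ee subrr.
have fe0 x : (1%:M - e x) *m e x = 0 by rewrite mulmxBl mul1mx ee subrr.
have [A [iA [pA [lA [qA [HpA HiA FA]]]]]] := rep_image He.
have [B [iB [pB [lB [qB [HpB HiB FB]]]]]] := rep_image Hf.
have small (f : vmap d d) : (forall x, f x *m f x = f x) ->
    ~ (forall x, f x = 1%:M) -> (total_dim (im_dim f) < total_dim d)%N.
  move=> idf f1; rewrite ltnNge; apply/negP => le_d; apply: f1 => x.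
  have uf : f x \in unitmx.
    apply: unitmx_rank.
    by rewrite -[X in (X <= _)%N](total_dim_leq_eq _ le_d) // => y; exact: rank_leq_row.
  by rewrite -[f x](mulKmx uf) idf mulVmx.
exists (im_dim e), (im_dim (fun x => 1%:M - e x)), A, B; split.
- exists iA, pA, iB, pB; split=> // x.
  have EA := FA x; have EB := FB x.
  have pA1 := idempotent_factorization EA (ee x).
  have pB1 := idempotent_factorization EB (ff x).
  case: (EA) => EAe lA1 qA1; case: (EB) => EBe lB1 qB1.
  split=> //.
  + apply: (mulmx_lcancel lA1); apply: (mulmx_rcancel qB1).
    by rewrite mulmx0 mul0mx mulmxA -EAe -mulmxA -EBe.
  + apply: (mulmx_lcancel lB1); apply: (mulmx_rcancel qA1).
    by rewrite mulmx0 mul0mx mulmxA -EBe -mulmxA -EAe.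
  + by rewrite -EAe -EBe addrC subrK.
- by move=> x; exact: rank_leq_row.
- by move=> x; exact: rank_leq_row.
- exact: small.
- apply: small => // f1; apply: e0 => x.
  by rewrite -[e x](subKr 1%:M) f1 subrr.
Qed.

(** Finiteness of the number of isomorphism classes, by means of a bounded complete
    invariant. *)
Definition finitely_many (d : dimvec) : Prop :=
  exists n (c : rep d -> nat), (forall M, c M < n)%N /\ forall M N, c M = c N -> isomorphic M N.

(** The isomorphism class of M is determined by the dimension vectors and the
    classes of the two parts of a decomposition; there is a single class of
    indecomposables, as they are rigid. *)
Lemma finitely_many_of_positive d :
  (forall e : dimvec, (forall x, e x <= d x)%N -> (exists x, 0 < e x)%N ->
    (dim_rep e < dim_group e)%N) ->
  finitely_many d.
Proof.
have [n] := ubnP (total_dim d); elim: n d => // n IHn d; rewrite ltnS => le_dn q_pos.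
(* A finite type containing all the dimension vectors below d. *)
pose FE := {ffun vertex Q -> 'I_(total_dim d).+1}.
pose dv (f : FE) : dimvec := fun x => f x.
pose small f := (forall x, dv f x <= d x)%N /\ (total_dim (dv f) < total_dim d)%N.
have /family_choice[b /family_choice[c cP]] : forall f : FE, exists b (c : rep (dv f) -> nat),
    small f -> (forall M, c M < b)%N /\ forall M N, c M = c N -> isomorphic M N.
  move=> f; have [[le_fd lt_fd]|nsm] := pselect (small f); last by exists 0%N, (fun=> 0%N).
  have [|e le_ef|b [c cP]] := IHn (dv f); first exact: leq_trans lt_fd le_dn.
    by apply: q_pos => x; exact: leq_trans (le_ef x) (le_fd x).
  by exists b, c.
pose B := (\max_f b f).+1.
(* The class None is that of the indecomposables; Some (f1, f2, (i1, i2)) is that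
   of the biproducts of parts with dimension vectors f1, f2 and invariants i1, i2. *)
pose R (M : rep d) (o : option (FE * FE * ('I_B * 'I_B))) := match o with
  | None => indecomposable M
  | Some (f1, f2, (i1, i2)) => [/\ small f1, small f2 &
    exists A B, [/\ biproduct M A B, c f1 A = i1 & c f2 B = i2]] end.
have R_iso M N o : R M o -> R N o -> isomorphic M N.
  case: o => [[[f1 f2] [i1 i2]]|] /=.
    move=> [s1 s2 [A [A2 [MA c1 c2]]]] [_ _ [A' [A2' [NA c1' c2']]]].
    have [_ i_1] := cP _ s1; have [_ i_2] := cP _ s2.
    by apply: (biproduct_isomorphic MA NA); [apply: i_1|apply: i_2]; congruence.
  move=> iM iN; have [d0|d0] := pselect (exists x, 0 < d x)%N.
    by apply: rigid_isomorphic; apply: indecomposable_rigid.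
  have d0' x : d x = 0%N by apply/eqP; rewrite -leqn0 leqNgt; apply/negP => dx; apply: d0; exists x.
  exists (fun=> 1%:M); split=> [x|a]; first exact: unitmx1.
  by apply/matrixP => i; have := ltn_ord i; rewrite [X in (_ < X)%N]d0'.
have R_ex M : exists o, R M o.
  have [iM|/decompose] := pselect (indecomposable M); first by exists None.
  move=> [dA [dB [A [A2 [MAB le1 le2 lt1 lt2]]]]].
  have dvE (e : dimvec) : (forall x, e x <= d x)%N -> exists f, dv f = e.
    move=> le_ed; exists [ffun x => inord (e x)].
    apply: functional_extensionality_dep => x; rewrite /dv ffunE inordK // ltnS.
    apply: leq_trans (le_ed x) _; rewrite /total_dim (bigD1 x) //=; exact: leq_addr.
  have [f1 f1E] := dvE _ le1; have [f2 f2E] := dvE _ le2; subst dA dB.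
  have s1 : small f1 by []. have s2 : small f2 by [].
  have ltB f A0 : small f -> (c f A0 < B)%N.
    move=> /cP[/(_ A0) h _]; apply: ltn_trans h _.
    by rewrite ltnS; exact: leq_bigmax.
  exists (Some (f1, f2, (Ordinal (ltB _ A s1), Ordinal (ltB _ A2 s2)))); split=> //.
  by exists A, A2.
have /choice[o oP] := R_ex.
exists #|{: option (FE * FE * ('I_B * 'I_B))}|, (fun M => nat_of_ord (enum_rank (o M))); split.
  by move=> M; exact: ltn_ord.
move=> M N /val_inj/enum_rank_inj E; apply: (R_iso _ _ (o M)) => //; rewrite E //.
Qed.

End Rigidity.

(** * Polynomial functions and dimension counting *)

Section PolynomialFunctions.
Variables (k : fieldType) (I : finType).
Implicit Types (u : I -> k) (f g : (I -> k) -> k).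

Definition monomial (e : I -> nat) u : k := \prod_i u i ^+ e i.

(** The bound E is on the degree in each variable separately: there are then
    (E + 1)^|I| monomials. *)
Definition polyfun (E : nat) f : Prop :=
  exists s : seq (k * {ffun I -> nat}),
    (forall t, t \in s -> forall i, t.2 i <= E)%N /\
    forall u, f u = \sum_(t <- s) t.1 * monomial t.2 u.

Lemma polyfunW E E' f : (E <= E')%N -> polyfun E f -> polyfun E' f.
Proof.
move=> le [s [sE fE]]; exists s; split=> // t ts i; exact: leq_trans (sE t ts i) le.
Qed.

Lemma polyfun_const E a : polyfun E (fun=> a).
Proof.
exists [:: (a, [ffun=> 0%N])]; split=> [t|u].
  by rewrite inE => /eqP-> i /=; rewrite ffunE.
rewrite big_seq1 /= /monomial big1 ?mulr1 // => i _; by rewrite ffunE.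
Qed.

Lemma polyfun_var i : polyfun 1 (fun u => u i).
Proof.
exists [:: (1, [ffun j => (j == i) : nat])]; split=> [t|u].
  by rewrite inE => /eqP-> j /=; rewrite ffunE; case: (j == i).
rewrite big_seq1 /= /monomial (bigD1 i) //= big1 ?ffunE ?eqxx ?mulr1 ?mul1r //.
by move=> j ji; rewrite ffunE (negbTE ji).
Qed.

Lemma polyfun_add E f g : polyfun E f -> polyfun E g -> polyfun E (fun u => f u + g u).
Proof.
move=> [s [sE fE]] [t [tE gE]]; exists (s ++ t); split=> [x|u].
  by rewrite mem_cat => /orP[/sE|/tE].
by rewrite big_cat fE gE.
Qed.

Lemma polyfun_mul E E' f g : polyfun E f -> polyfun E' g ->
  polyfun (E + E') (fun u => f u * g u).
Proof.
move=> [s [sE fE]] [t [tE gE]].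
pose m (x y : k * {ffun I -> nat}) : k * {ffun I -> nat} :=
  (x.1 * y.1, [ffun i => (x.2 i + y.2 i)%N]).
exists [seq m x y | x <- s, y <- t]; split=> [x|u].
  by move=> /allpairsP[[y z] /= [ys zt ->]] i /=; rewrite ffunE leq_add ?sE ?tE.
rewrite big_allpairs_dep fE gE big_distrl /=; apply: eq_bigr => x _.
rewrite big_distrr /=; apply: eq_bigr => y _.
rewrite mulrACA; congr (_ * _); rewrite /monomial -big_split /=.
by apply: eq_bigr => i _; rewrite ffunE exprD.
Qed.

Lemma polyfun_exp E n f : polyfun E f -> polyfun (n * E) (fun u => f u ^+ n).
Proof.
move=> fE; elim: n => [|n IHn].
  by rewrite (_ : (fun u => _) = (fun=> 1)); [exact: polyfun_const | exact: funext].
rewrite (_ : (fun u => _) = (fun u => f u * f u ^+ n)); last by apply: funext => u; rewrite exprS.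
exact: polyfun_mul.
Qed.

Lemma polyfun_prod (T : Type) (r : seq T) (E : T -> nat) (f : T -> (I -> k) -> k) :
  (forall t, polyfun (E t) (f t)) ->
  polyfun (\sum_(t <- r) E t) (fun u => \prod_(t <- r) f t u).
Proof.
move=> fE; elim: r => [|t r IHr].
  rewrite big_nil (_ : (fun u => _) = (fun=> 1)); first exact: polyfun_const.
  by apply: funext => u; rewrite big_nil.
rewrite big_cons (_ : (fun u => _) = (fun u => f t u * \prod_(t <- r) f t u)).
  exact: polyfun_mul.
by apply: funext => u; rewrite big_cons.
Qed.

Lemma polyfun_coef E f : polyfun E f ->
  exists c : {ffun I -> 'I_E.+1} -> k, forall u, f u = \sum_e c e * \prod_i u i ^+ e i.
Proof.
move=> [s [sE fE]].
pose tr (e : {ffun I -> nat}) : {ffun I -> 'I_E.+1} := [ffun i => inord (e i)].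
exists (fun e => \sum_(t <- s | tr t.2 == e) t.1) => u.
rewrite fE (partition_big (fun t => tr t.2) xpredT) //=; apply: eq_bigr => e _.
rewrite big_distrl /= big_seq_cond [RHS]big_seq_cond.
apply: eq_bigr => t /andP[ts /eqP te]; congr (_ * _); apply: eq_bigr => i _.
by rewrite -te ffunE inordK // ltnS sE.
Qed.

Definition polynomial_fun f := exists E, polyfun E f.

Lemma polynomial_const a : polynomial_fun (fun=> a).
Proof. by exists 0%N; exact: polyfun_const. Qed.

Lemma polynomial_add f g : polynomial_fun f -> polynomial_fun g ->
  polynomial_fun (fun u => f u + g u).
Proof.
move=> [E fE] [E' gE]; exists (E + E')%N; apply: polyfun_add.
  by apply: polyfunW fE; exact: leq_addr.
by apply: polyfunW gE; exact: leq_addl.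
Qed.

Lemma polynomial_mul f g : polynomial_fun f -> polynomial_fun g ->
  polynomial_fun (fun u => f u * g u).
Proof. by move=> [E fE] [E' gE]; exists (E + E')%N; exact: polyfun_mul. Qed.

Lemma polynomial_sum (T : Type) (r : seq T) (P : pred T) (f : T -> (I -> k) -> k) :
  (forall t, polynomial_fun (f t)) -> polynomial_fun (fun u => \sum_(t <- r | P t) f t u).
Proof.
move=> fE; elim: r => [|t r IHr].
  rewrite (_ : (fun u => _) = (fun=> 0)); first exact: polynomial_const.
  by apply: funext => u; rewrite big_nil.
rewrite (_ : (fun u => _) = (fun u => (if P t then f t u else 0) + \sum_(t <- r | P t) f t u)).
  by apply: polynomial_add => //; case: (P t) => //; exact: polynomial_const.
by apply: funext => u; rewrite big_cons; case: (P t); rewrite ?add0r.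
Qed.

Lemma polynomial_prod (T : Type) (r : seq T) (P : pred T) (f : T -> (I -> k) -> k) :
  (forall t, polynomial_fun (f t)) -> polynomial_fun (fun u => \prod_(t <- r | P t) f t u).
Proof.
move=> fE; elim: r => [|t r IHr].
  rewrite (_ : (fun u => _) = (fun=> 1)); first exact: polynomial_const.
  by apply: funext => u; rewrite big_nil.
rewrite (_ : (fun u => _) = (fun u => (if P t then f t u else 1) * \prod_(t <- r | P t) f t u)).
  by apply: polynomial_mul => //; case: (P t) => //; exact: polynomial_const.
by apply: funext => u; rewrite big_cons; case: (P t); rewrite ?mul1r.
Qed.

Definition polynomial_mx m n (A : (I -> k) -> 'M[k]_(m, n)) :=
  forall i j, polynomial_fun (fun u => A u i j).

Lemma polynomial_mulmx m n p (A : (I -> k) -> 'M_(m, n)) (B : (I -> k) -> 'M_(n, p)) :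
  polynomial_mx A -> polynomial_mx B -> polynomial_mx (fun u => A u *m B u).
Proof.
move=> pA pB i j; rewrite (_ : (fun u => _) = (fun u => \sum_l A u i l * B u l j)).
  by apply: polynomial_sum => l; exact: polynomial_mul.
by apply: funext => u; rewrite mxE.
Qed.

Lemma polynomial_det n (A : (I -> k) -> 'M_n) :
  polynomial_mx A -> polynomial_fun (fun u => \det (A u)).
Proof.
move=> pA; apply: polynomial_sum => s; apply: polynomial_mul; first exact: polynomial_const.
by apply: polynomial_prod.
Qed.

Lemma polynomial_adj n (A : (I -> k) -> 'M_n) :
  polynomial_mx A -> polynomial_mx (fun u => \adj (A u)).
Proof.
move=> pA i j; rewrite (_ : (fun u => _) = (fun u => cofactor (A u) j i)); last first.
  by apply: funext => u; rewrite mxE.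
apply: polynomial_mul; first exact: polynomial_const.
apply: polynomial_det => a b.
by rewrite (_ : (fun u => _) = (fun u => A u (lift j a) (lift i b)));
  [exact: pA | apply: funext => u; rewrite !mxE].
Qed.

End PolynomialFunctions.

Lemma polyfun_uniform (k : fieldType) (T : finType) (I : T -> finType)
    (f : forall t, (I t -> k) -> k) :
  (forall t, polynomial_fun (f t)) -> exists E, forall t, polyfun E (f t).
Proof.
move=> /choice[E fE]; exists (\max_t E t) => t.
by apply: polyfunW (fE t); exact: leq_bigmax.
Qed.

Lemma linear_dependency (k : fieldType) (A B : finType) (C : A -> B -> k) :
  (#|B| < #|A|)%N -> exists c : A -> k, (exists a, c a != 0) /\
    forall b, \sum_a c a * C a b = 0.
Proof.
move=> ltBA; pose X : 'M_(#|A|, #|B|) := \matrix_(i, j) C (enum_val i) (enum_val j).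
have : kermx X != 0.
  rewrite -mxrank_eq0 mxrank_ker subn_eq0 -ltnNge.
  exact: leq_ltn_trans (rank_leq_col _) ltBA.
move=> /rowV0Pn[v /sub_kermxP vX v0].
exists (fun a => v 0 (enum_rank a)); split.
  by have /rV0Pn[i vi] := v0; exists (enum_val i); rewrite enum_valK.
move=> b; rewrite (reindex (@enum_val A predT)) /=; last first.
  by exists enum_rank => ? _; rewrite ?enum_valK ?enum_rankK.
transitivity ((v *m X) 0 (enum_rank b)); last by rewrite vX mxE.
by rewrite mxE; apply: eq_bigr => i _; rewrite enum_valK mxE enum_rankK.
Qed.

(** Uniqueness of digits in base B, for expansions of length n. *)
Lemma digits_inj n B (f g : 'I_n -> nat) :
  (forall i, f i < B)%N -> (forall i, g i < B)%N ->
  (\sum_i f i * B ^ i = \sum_i g i * B ^ i)%N -> forall i, f i = g i.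
Proof.
elim: n f g => [f g _ _ _ []//|n IHn f g fB gB].
have step (h : 'I_n.+1 -> nat) :
    (\sum_i h i * B ^ i = h ord0 + (\sum_i h (lift ord0 i) * B ^ i) * B)%N.
  rewrite big_ord_recl muln1 big_distrl /=; congr (_ + _)%N; apply: eq_bigr => i _.
  by rewrite expnSr mulnA.
rewrite !step => E.
have E0 : f ord0 = g ord0.
  by have := congr1 (modn^~ B) E; rewrite /= ![(_ + _ * B)%N]addnC !modnMDl !modn_small.
have B0 : (0 < B)%N by exact: leq_ltn_trans (fB ord0).
have E1 : (\sum_i f (lift ord0 i) * B ^ i = \sum_i g (lift ord0 i) * B ^ i)%N.
  by move: E; rewrite E0 => /addnI/eqP; rewrite eqn_pmul2r // => /eqP.
move=> i; have [j ->|->//] := unliftP ord0 i.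
by apply: (IHn (fun j => f (lift ord0 j)) (fun j => g (lift ord0 j))).
Qed.

(** Kronecker's substitution: raising t to successive powers of D + 1 turns distinct
    monomials of degree at most D in each variable into distinct powers of t. *)
Lemma exists_nonzero_value (k : closedFieldType) (R : finType) D
    (c : {ffun R -> 'I_D.+1} -> k) e0 : c e0 != 0 ->
  exists z : R -> k, \sum_e c e * \prod_i z i ^+ e i != 0.
Proof.
move=> c0; pose w (e : {ffun R -> 'I_D.+1}) := (\sum_i e i * D.+1 ^ enum_rank i)%N.
have w_inj : injective w.
  move=> e e' E; apply/ffunP => i.
  have conv (h : {ffun R -> 'I_D.+1}) : (w h = \sum_(j < #|R|) h (enum_val j) * D.+1 ^ j)%N.
    rewrite /w (reindex (@enum_val R predT)) /=; last first.
      by exists enum_rank => ? _; rewrite ?enum_valK ?enum_rankK.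
    by apply: eq_bigr => j _; rewrite enum_valK.
  move: E; rewrite !conv => E; apply: val_inj; rewrite -[i]enum_rankK.
  by apply: (digits_inj _ _ E) => j; exact: ltn_ord.
pose P : {poly k} := \sum_e c e *: 'X^(w e).
have P0 : P != 0.
  apply: contra c0 => /eqP/(congr1 (fun r : {poly k} => r`_(w e0))).
  rewrite coef0 coef_sum (bigD1 e0) //= coefZ coefXn eqxx mulr1 big1 ?addr0 => [-> //|e ne].
  by rewrite coefZ coefXn (inj_eq w_inj) eq_sym (negbTE ne) mulr0.
have /closed_nonrootP[t Pt] := P0.
exists (fun i => t ^+ (D.+1 ^ enum_rank i)); move: Pt.
rewrite rootE horner_sum; congr (_ != 0); apply: eq_bigr => e _.
rewrite !hornerE; congr (_ * _); rewrite /w.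
rewrite -prodrXr; apply: eq_bigr => i _; by rewrite -exprM mulnC.
Qed.

(** Finitely many rational maps F j / delta j from affine spaces of dimension less
    than |R| do not cover the affine space with coordinates R: all the images lie
    in the zero set of one nonzero polynomial. *)
Lemma avoid_images (k : closedFieldType) (J : finType) (I : J -> finType) (R : finType)
    (F : forall j, R -> (I j -> k) -> k) (delta : forall j, (I j -> k) -> k) :
  (forall j a, polynomial_fun (F j a)) -> (forall j, polynomial_fun (delta j)) ->
  (forall j, #|I j| < #|R|)%N ->
  exists z : R -> k, forall j u, delta j u != 0 -> exists a, z a * delta j u != F j a u.
Proof.
move=> pF pdelta ltIR.
have [E1 dE1] := polyfun_uniform pdelta.
have [E2 FE2] := polyfun_uniform (fun t : J * R => pF t.1 t.2).
pose e := maxn E1 E2; set N := #|R| in ltIR *.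
have dE j : polyfun e (delta j) by apply: polyfunW (dE1 j); exact: leq_maxl.
have FE j a : polyfun e (F j a) by apply: polyfunW (FE2 (j, a)); exact: leq_maxr.
(* A polynomial of degree at most D in each of the N coordinates pulls back, after
   multiplication by delta^(N D), to one of degree at most L = e N D in each
   variable.  There are (D + 1)^N monomials before and at most
   |J| (L + 1)^(N - 1) <= D (D + 1)^(N - 1) after, hence a linear dependency. *)
pose D := (#|J| * (e * N).+1 ^ N.-1)%N.
pose A : finType := {ffun R -> 'I_D.+1}.
pose L := (e * (N * D))%N.
pose wt (b : A) := (\sum_a b a)%N.
have wt_le b : (wt b <= N * D)%N.
  rewrite /wt; apply: (@leq_trans (\sum_(a : R) D)); last by rewrite sum_nat_const.
  by apply: leq_sum => a _; rewrite -ltnS.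
pose G (b : A) j (u : I j -> k) := delta j u ^+ (N * D - wt b) * \prod_a F j a u ^+ b a.
have GE b j : polyfun L (@G b j).
  have -> : L = ((N * D - wt b) * e + \sum_a b a * e)%N.
    by rewrite -big_distrl /= -mulnDl -/(wt b) subnK // mulnC.
  apply: polyfun_mul; first exact: polyfun_exp.
  by apply: polyfun_prod => a; exact: polyfun_exp.
have /family_choice[C CE] := fun bj : A * J => polyfun_coef (GE bj.1 bj.2).
pose B : finType := {j : J & {ffun I j -> 'I_L.+1}}.
have ltBA : (#|B| < #|A|)%N.
  rewrite card_tagged sumnE big_map big_enum /= card_ffun card_ord -/N.
  have le_j j : (#|{ffun I j -> 'I_L.+1}| <= (e * N).+1 ^ N.-1 * D.+1 ^ N.-1)%N.
    rewrite card_ffun card_ord -expnMn.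
    have NI : (#|I j| <= N.-1)%N by have := ltIR j; lia.
    apply: (@leq_trans (L.+1 ^ N.-1)); first by rewrite leq_pexp2l.
    by case: (N.-1) => // n; rewrite leq_exp2r // /L; nia.
  apply: (@leq_ltn_trans (D * D.+1 ^ N.-1)).
    apply: leq_trans (leq_sum _ (fun j _ => le_j j)) _.
    by rewrite sum_nat_const mulnA.
  have [j0|/card_gt0P[j _]] := posnP #|J|; last first.
    rewrite -[in X in (_ < X)%N](ltn_predK (leq_ltn_trans (leq0n _) (ltIR j))).
    by rewrite expnS ltn_pmul2r ?expn_gt0.
  by rewrite /D j0 mul0n expn_gt0.
have [c [[e0 c0] cC]] := linear_dependency (fun b (jm : B) => C (b, tag jm) (tagged jm)) ltBA.
have [z Fz] := exists_nonzero_value c0.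
exists z => j u du; apply: contrapT => /forallNP nz.
have zE a : z a * delta j u = F j a u by apply/eqP/negPn/negP; exact: nz.
move/negP: Fz; apply; rewrite -(mulIr_eq0 _ (mulIf (expf_neq0 (N * D) du))).
rewrite big_distrl /=; apply/eqP.
transitivity (\sum_b c b * G b j u).
  apply: eq_bigr => b _; rewrite -mulrA; congr (_ * _); rewrite /G.
  rewrite -[in LHS](subnK (wt_le b)) exprD mulrCA; congr (_ * _).
  rewrite /wt -prodrXr -big_split /=; apply: eq_bigr => a _.
  by rewrite -zE exprMn.
under eq_bigr do rewrite (CE (_, j)) big_distrr /=.
rewrite exchange_big big1 //= => m _.
under eq_bigr do rewrite mulrA.
by rewrite -big_distrl /= (cC (Tagged (fun j => {ffun I j -> 'I_L.+1}) m)) mul0r.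
Qed.

(** * Infinitely many orbits when the Tits form is nonpositive *)

Section Infinite.
Variables (k : closedFieldType) (Q : quiver).
Notation dimvec := (dimvec Q).
Notation rep := (@rep k Q).
Notation vmap := (@vmap k Q).

(** Up to a scalar, which acts trivially, some entry of g at x0 equals 1.  Fixing
    the representative M j and this entry leaves dim_group d - 1 variables, and
    the coordinates of g M g^-1 are polynomials in them divided by the product
    delta of the determinants. *)
Lemma orbits_do_not_cover (d : dimvec) : (exists x, 0 < d x)%N -> (dim_group d <= dim_rep d)%N ->
  forall r (M : 'I_r -> rep d), exists N : rep d, forall j, ~ isomorphic (M j) N.
Proof.
move=> [x0 dx0] q_neg r M.
pose J : finType := ('I_r * entry d d)%type.
pose I (j : J) : finType := {i : entry d d | i != j.2}.
pose ext j (u : I j -> k) (i : entry d d) : k := if insub i is Some i' then u i' else 1.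
pose g j (u : I j -> k) x : 'M[k]_(d x) :=
  \matrix_(a, b) ext j u (Tagged (fun x => ('I_(d x) * 'I_(d x))%type) (a, b)).
pose delta j (u : I j -> k) := \prod_x \det (g j u x).
pose R : finType := entry (fun a : arrow Q => d (tgt a)) (fun a => d (src a)).
pose F j (t : R) (u : I j -> k) := let a := tag t in
  (g j u (tgt a) *m M j.1 a *m \adj (g j u (src a))) (tagged t).1 (tagged t).2 *
  \prod_(x | x != src a) \det (g j u x).
have pg j x : polynomial_mx (fun u => g j u x).
  move=> a b; rewrite /g /ext.
  pose i : entry d d := Tagged (fun x => ('I_(d x) * 'I_(d x))%type) (a, b).
  case: (boolP (i != j.2)) => ni.
    rewrite (_ : (fun u => _) = (fun u => u (exist _ i ni))).
      by exists 1%N; exact: polyfun_var.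
    by apply: funext => u; rewrite mxE (insubT (fun i => i != j.2) ni).
  rewrite (_ : (fun u => _) = (fun=> 1)); first exact: polynomial_const.
  by apply: funext => u; rewrite mxE insubN.
have pF j t : polynomial_fun (F j t).
  apply: polynomial_mul; last by apply: polynomial_prod => x; exact: polynomial_det.
  apply: polynomial_mulmx; last exact: polynomial_adj.
  by apply: polynomial_mulmx => // a b; exact: polynomial_const.
have pd j : polynomial_fun (delta j).
  by apply: polynomial_prod => x; exact: polynomial_det.
have ltIR j : (#|I j| < #|R|)%N.
  rewrite card_sig cardC1 -/(#|{: entry d d}|).
  have := card_entry d d; have := card_entry (fun a : arrow Q => d (tgt a)) (fun a => d (src a)).
  rewrite -/(dim_rep d) -/(dim_group d) -/R => -> ->.
  have : (0 < dim_group d)%N by rewrite /dim_group (bigD1 x0) //= addn_gt0 muln_gt0 dx0.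
  lia.
have [z zP] := avoid_images pF pd ltIR.
exists (fun a => \matrix_(b, c)
  z (Tagged (fun a => ('I_(d (tgt a)) * 'I_(d (src a)))%type) (b, c))).
move=> j [h [uh Hh]].
have [b [c hbc]] : exists b c, h x0 b c != 0.
  apply: contrapT => h0; have : \rank (h x0) = d x0 by rewrite mxrank_unit.
  suff -> : h x0 = 0 by move=> z0; rewrite -z0 mxrank0 in dx0.
  apply/matrixP => b c; rewrite mxE; apply: contrapT => /eqP hbc.
  by apply: h0; exists b, c.
pose t0 : entry d d := Tagged (fun x => ('I_(d x) * 'I_(d x))%type) (b, c).
pose h' x := (h x0 b c)^-1 *: h x.
pose u (i : I (j, t0)) : k := h' (tag (val i)) (tagged (val i)).1 (tagged (val i)).2.
have gE x : g (j, t0) u x = h' x.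
  apply/matrixP => p q; rewrite mxE /ext; case: insubP => [i' _ iE|].
    by rewrite /u iE.
  rewrite negbK => /eqP E.
  have -> : h' x p q = (fun t : entry d d => h' (tag t) (tagged t).1 (tagged t).2)
     (Tagged (fun x => ('I_(d x) * 'I_(d x))%type) (p, q)) by [].
  by rewrite E /= /h' mxE mulVf.
have uh' x : h' x \in unitmx by rewrite unitmxZ ?uh // unitfE invr_eq0.
have [|[a [p q]]] := zP (j, t0) u.
  by apply/prodf_neq0 => x _; rewrite gE; have := uh' x; rewrite unitmxE unitfE.
apply/negP; rewrite negbK; apply/eqP.
rewrite /delta /F /= (bigD1 (src a)) //= mulrA; congr (_ * _).
rewrite !gE.
have Hh' := Hh a.
have -> : z (Tagged (fun a => ('I_(d (tgt a)) * 'I_(d (src a)))%type) (p, q)) =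
  (h' (tgt a) *m M j a *m invmx (h' (src a))) p q.
  set N : 'M_(_, _) := _ *m invmx _.
  suff -> : N = \matrix_(b, c) z (Tagged (fun a => ('I_(d (tgt a)) * 'I_(d (src a)))%type) (b, c)).
    by rewrite mxE.
  apply: (canLR (mulmxK (uh' _))).
  by rewrite /h' -scalemxAl -scalemxAr Hh.
rewrite /invmx uh' -scalemxAr mxE mulrAC mulVf ?mul1r //.
by have := uh' (src a); rewrite unitmxE unitfE.
Qed.

Lemma isomorphicP (d : dimvec) (M N : rep d) :
  isomorphic M N <-> @rep_iso k (QuiverSetting d) M N.
Proof.
split=> [[g [ug Hg]]|[g [ug Hg]]]; exists g; split=> // a.
  by rewrite Hg mulmxK.
by rewrite [N a]Hg mulmxKV.
Qed.

Lemma rep_infinite_of_nonpositive (d : dimvec) :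
  (exists x, 0 < d x)%N -> (dim_group d <= dim_rep d)%N ->
  rep_infinite k (QuiverSetting d).
Proof.
move=> d0 q_neg /finite_seqP[s sE].
have reps i : exists M : rep d, (i < size s)%N -> nth set0 s i = @iso_class k (QuiverSetting d) M.
  have [lt|ge] := ltnP i (size s); last by exists (fun=> 0).
  have : range (@iso_class k (QuiverSetting d)) (nth set0 s i) by rewrite sE /=; exact: mem_nth.
  by move=> [M _ ME]; exists M.
have /choice[M ME] := reps.
have [N nN] := orbits_do_not_cover d0 q_neg (fun j : 'I_(size s) => M j).
have : range (@iso_class k (QuiverSetting d)) (@iso_class k (QuiverSetting d) N) by exists N.
rewrite sE /= => /nthP - /(_ set0)[i lt_i iE].
apply: (nN (Ordinal lt_i)) => /=; apply/isomorphicP.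
have : nth set0 s i N by rewrite iE; apply/isomorphicP; exists (fun=> 1%:M); split=> [x|a];
  rewrite ?unitmx1 ?mul1mx ?mulmx1.
by rewrite ME.
Qed.

Lemma rep_finite_of_finitely_many (d : dimvec) : @finitely_many k Q d ->
  rep_finite k (QuiverSetting d).
Proof.
move=> [n [c [cn cP]]].
have /choice[f fE] : forall i, exists X, forall M, c M = i -> @iso_class k (QuiverSetting d) M = X.
  move=> i; have [[M0 M0i]|no] := pselect (exists M, c M = i); last first.
    by exists set0 => M Mi; case: no; exists M.
  exists (@iso_class k (QuiverSetting d) M0) => M Mi.
  have MM0 : isomorphic M M0 by apply: cP; rewrite Mi M0i.
  apply/seteqP; split=> N /isomorphicP MN; apply/isomorphicP.
    exact: isomorphic_trans (isomorphic_sym MM0) MN.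
  exact: isomorphic_trans MM0 MN.
apply: (sub_finite_set (B := [set f i | i in `I_n]%classic)).
  by move=> X [M _ <-]; exists (c M) => /=; [exact: cn | rewrite (fE _ M erefl)].
exact/finite_image/finite_II.
Qed.

End Infinite.

Local Close Scope ring_scope.
Local Open Scope nat_scope.

(** * Orientations of the Euclidean graphs *)

Definition tree_parent (p : seq nat) (i : 'I_(size p)) : 'I_(size p).+1 :=
  inord (nth 0 p i).

Definition edge_tail (T : euclidean_type) :
    gedge (euclidean_graph T) -> gvertex (euclidean_graph T) :=
  match T with
  | EuclA n => fun i => i
  | EuclD m => fun e => inl match e with
      | inl i => widen_ord (leqnSn m) i
      | inr (e, b) => if e then ord_max else ord0
      end
  | EuclE6 => @tree_parent _
  | EuclE7 => @tree_parent _
  | EuclE8 => @tree_parent _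
  end.

Definition edge_head (T : euclidean_type) :
    gedge (euclidean_graph T) -> gvertex (euclidean_graph T) :=
  match T with
  | EuclA n => fun i => ordS i
  | EuclD m => fun e => match e with
      | inl i => inl (lift ord0 i)
      | inr x => inr x
      end
  | EuclE6 => lift ord0
  | EuclE7 => lift ord0
  | EuclE8 => lift ord0
  end.

Lemma ends_tail_head T (e : gedge (euclidean_graph T)) : ends e = [set edge_tail e; edge_head e].
Proof. by case: T e => // m [i|[[] b]]. Qed.

Lemma set2_inj (V : finType) (a b c d : V) : [set a; b] = [set c; d] ->
  (a = c /\ b = d) \/ (a = d /\ b = c).
Proof.
move=> E.
have : a \in [set c; d] by rewrite -E set21.
have : b \in [set c; d] by rewrite -E set22.
have : c \in [set a; b] by rewrite E set21.
have : d \in [set a; b] by rewrite E set22.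
rewrite !inE => /orP[]/eqP ? /orP[]/eqP ? /orP[]/eqP ? /orP[]/eqP ?; subst; auto.
Qed.

Lemma sum_ord_eqn m (i : nat) : \sum_(j < m) (j == i :> nat) = (i < m).
Proof.
elim: m => [|m IHm]; first by rewrite big_ord0.
rewrite big_ord_recr /= IHm; lia.
Qed.

Lemma sum_bool2 (F : bool * bool -> nat) :
  \sum_p F p = F (true, true) + F (true, false) + (F (false, true) + F (false, false)).
Proof.
rewrite (eq_bigr (fun p => F (p.1, p.2))) => [|[]//].
by rewrite -(pair_bigA _ (fun a b => F (a, b))) /= !big_bool.
Qed.

(** For a concrete tree, being harmonic is a finite computation on the parent and
    value lists. *)
Lemma tree_harmonic (p w : seq nat) :
  all (fun i => nth 0 p i <= i) (iota 0 (size p)) ->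
  all (fun x => foldr addn 0 [seq (nth 0 p i == x) * nth 0 w i.+1 +
                 (i.+1 == x) * nth 0 w (nth 0 p i) | i <- iota 0 (size p)]
              == 2 * nth 0 w x) (iota 0 (size p).+1) ->
  forall x : 'I_(size p).+1,
    \sum_i ((@tree_parent p i == x) * nth 0 w (lift ord0 i) +
            (lift ord0 i == x) * nth 0 w (tree_parent i)) = 2 * nth 0 w x.
Proof.
move=> /allP ple /allP H x.
have /H/eqP <- : (x : nat) \in iota 0 (size p).+1 by rewrite mem_iota /= add0n.
rewrite foldrE big_map -[X in iota _ X]subn0 big_mkord.
apply: eq_bigr => i _; rewrite -!val_eqE /= /bump /= add1n inordK //.
by have := ple i; rewrite mem_iota ltnS => /(_ (ltn_ord i)) h; apply: leq_trans h (ltnW _).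
Qed.

Lemma tree_connected (p : seq nat) (P : 'I_(size p).+1 -> bool) :
  all (fun i => nth 0 p i <= i) (iota 0 (size p)) ->
  (forall i, P (@tree_parent p i) = P (lift ord0 i)) -> forall x, P x = P ord0.
Proof.
move=> /allP ple PE x; have [n] := ubnP (val x); elim: n x => // n IHn x lt_xn.
have [i xE|->//] := unliftP ord0 x; rewrite xE -PE; apply: IHn.
have := ple i; rewrite mem_iota /= => /(_ (ltn_ord i)) le_i.
rewrite /tree_parent /= inordK.
  by apply: leq_ltn_trans le_i _; move: lt_xn; rewrite xE.
by rewrite ltnS; apply: leq_trans le_i (ltnW _).
Qed.

Local Notation hvec := euclidean_vector.

Lemma euclidean_harmonic T (x : gvertex (euclidean_graph T)) :
  \sum_e ((edge_tail e == x) * hvec (edge_head e) +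
          (edge_head e == x) * hvec (edge_tail e)) = 2 * hvec x.
Proof.
case: T x => [n|m|||] x.
- rewrite big_split /= (bigD1 x) //= eqxx big1 ?addn0 => [|i /negbTE -> //].
  rewrite [X in _ + X](reindex_inj (@ord_pred_inj n.+1)) /=.
  rewrite (bigD1 x) //= ord_predK eqxx big1 // => i; rewrite ord_predK => /negbTE -> //.
- rewrite big_sumType sum_bool2 /=; case: x => [i|[e b]] /=.
    rewrite big_split /= -!big_distrl /=.
    under eq_bigr do rewrite (inj_eq inl_inj) -val_eqE /=.
    rewrite sum_ord_eqn.
    have -> : \sum_(j < m) (inl (lift ord0 j) == inl i :> 'I_m.+1 + bool * bool) = (0 < i).
      case: i => -[|i] lt_i /=; first by rewrite big1.
      have <- : (i < m : nat) = 1 by rewrite -ltnS lt_i.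
      rewrite -(sum_ord_eqn m i); apply: eq_bigr => j _.
      by rewrite (inj_eq inl_inj) -val_eqE.
    rewrite !(inj_eq inl_inj) -!val_eqE /=; have := ltn_ord i; lia.
  rewrite big1 //=; case: e; case: b => //.
- by apply: (@tree_harmonic [:: 0; 1; 0; 3; 0; 5] [:: 3; 2; 1; 2; 1; 2; 1]); vm_compute.
- by apply: (@tree_harmonic [:: 0; 1; 2; 0; 4; 5; 0] [:: 4; 3; 2; 1; 3; 2; 1; 2]); vm_compute.
- by apply: (@tree_harmonic [:: 0; 1; 2; 3; 4; 0; 6; 0] [:: 6; 5; 4; 3; 2; 1; 4; 2; 3]); vm_compute.
Qed.

Lemma euclidean_connected T (P : gvertex (euclidean_graph T) -> bool) :
  (forall e, P (edge_tail e) = P (edge_head e)) -> forall x y, P x = P y.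
Proof.
move=> PE; suff [z Pz] : exists z, forall x, P x = P z by move=> x y; rewrite !Pz.
case: T P PE => [n|m|||] P PE.
- exists ord0 => -[i lt_i]; elim: i lt_i => [|i IHi] lt_i; first by congr P; apply: val_inj.
  rewrite -(IHi (ltnW lt_i)); have /= -> := PE (Ordinal (ltnW lt_i)).
  by congr P; apply: val_inj; rewrite /= modn_small.
- exists (inl ord0).
  have Pc i : P (inl i) = P (inl ord0).
    case: i => i lt_i; elim: i lt_i => [|i IHi] lt_i; first by congr (P (inl _)); apply: val_inj.
    rewrite -(IHi (ltnW lt_i)); have := PE (inl (Ordinal (lt_i : i < m))) => /= E.
    by rewrite (_ : Ordinal lt_i = lift ord0 (Ordinal (lt_i : i < m))) -?E;
      [congr (P (inl _)) | ]; apply: val_inj.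
  by move=> [i|[e b]]; rewrite ?Pc // -(PE (inr (e, b))) /= Pc.
- exists ord0; exact: (@tree_connected [:: 0; 1; 0; 3; 0; 5]).
- exists ord0; exact: (@tree_connected [:: 0; 1; 2; 0; 4; 5; 0]).
- exists ord0; exact: (@tree_connected [:: 0; 1; 2; 3; 4; 0; 6; 0]).
Qed.

Lemma euclidean_vector_gt0 T (x : gvertex (euclidean_graph T)) : 0 < hvec x.
Proof.
case: T x => [n|m|||] x //=; first (by case: x);
  by case: x => -[|[|[|[|[|[|[|[|[|x]]]]]]]]].
Qed.

Lemma euclidean_vector_unit T : exists x : gvertex (euclidean_graph T), hvec x = 1.
Proof.
case: T => [n|m|||].
- by exists ord0.
- by exists (inr (false, false)).
- by exists (@Ordinal 7 2 isT).
- by exists (@Ordinal 8 3 isT).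
- by exists (@Ordinal 9 5 isT).
Qed.

(** * Harmonic dimension vectors *)

Section Harmonic.
Variable Q : quiver.
Implicit Types d f g : vertex Q -> nat.

(** A loop at x contributes twice. *)
Definition neighbor_sum d (x : vertex Q) : nat :=
  \sum_a ((src a == x) * d (tgt a) + (tgt a == x) * d (src a)).

Lemma sum_select f z : \sum_x (z == x :> vertex Q) * f x = f z.
Proof.
rewrite (bigD1 z) //= eqxx mul1n big1 ?addn0 // => x; rewrite eq_sym => /negbTE -> //.
Qed.

Lemma sum_mul_neighbor_sum f g :
  \sum_x f x * neighbor_sum g x = \sum_a (f (src a) * g (tgt a) + f (tgt a) * g (src a)).
Proof.
under eq_bigr do rewrite big_distrr /=.
rewrite exchange_big /=; apply: eq_bigr => a _.
under eq_bigr do rewrite mulnDr !(mulnCA (f _)).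
rewrite big_split /=; congr (_ + _).
  by rewrite (sum_select (fun x => f x * g (tgt a))).
by rewrite (sum_select (fun x => f x * g (src a))).
Qed.

Lemma sum_mul_neighbor_sumC f g : \sum_x f x * neighbor_sum g x = \sum_x g x * neighbor_sum f x.
Proof.
rewrite !sum_mul_neighbor_sum; apply: eq_bigr => a _; ring.
Qed.

(** The features of Euclidean vectors that make them pairwise incomparable; they
    do not refer to the classification. *)
Record euclidean_props d : Prop := EuclideanProps {
  ep_harmonic : forall x, neighbor_sum d x = 2 * d x;
  ep_connected : forall P : vertex Q -> bool,
    (forall a, P (src a) = P (tgt a)) -> forall x y, P x = P y;
  ep_gt0 : forall x, 0 < d x;
  ep_unit : exists x, d x = 1 }.

Lemma harmonic_dim_group_le d : (forall x, neighbor_sum d x = 2 * d x) -> dim_group d <= dim_rep d.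
Proof.
move=> hd; rewrite -(@leq_pmul2l 2) // /dim_group /dim_rep !big_distrr /=.
have := sum_mul_neighbor_sum d d.
under eq_bigr do rewrite hd.
under [RHS]eq_bigr do rewrite [d (src _) * _]mulnC addnn -mul2n.
by under eq_bigr do rewrite mulnCA; move=> ->.
Qed.

End Harmonic.

Lemma euclidean_setting_props (S : quiver_setting) : euclidean_setting S ->
  euclidean_props (@qs_dim S).
Proof.
move=> [T [fV [fE [[bV bE endsE] dE]]]].
have iV := bij_inj bV.
have fE_ends a : (fV (src a) = edge_tail (fE a) /\ fV (tgt a) = edge_head (fE a)) \/
                 (fV (src a) = edge_head (fE a) /\ fV (tgt a) = edge_tail (fE a)).
  apply: set2_inj; rewrite -ends_tail_head endsE /= imsetU1 imset_set1 //.
split.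
- move=> x; rewrite dE -euclidean_harmonic (reindex fE) /=; last exact: onW_bij.
  apply: eq_bigr => a _; rewrite !dE -!(inj_eq iV).
  by have [[-> ->]|[-> ->]] := fE_ends a; rewrite // addnC.
- move=> P PE x y; have [g gK Kg] := bV.
  rewrite -[x]gK -[y]gK; apply: (euclidean_connected (P := fun z => P (g z))) => e.
  have [h hK Kh] := bE; rewrite -[e]Kh.
  by have [[<- <-]|[<- <-]] := fE_ends (h e); rewrite !gK PE.
- by move=> x; rewrite dE euclidean_vector_gt0.
- have [z z1] := euclidean_vector_unit T; have [g gK Kg] := bV.
  by exists (g z); rewrite dE Kg.
Qed.

Lemma sum_codom (A B : finType) (f : A -> B) (F : B -> nat) : injective f ->
  \sum_(b in codom f) F b = \sum_a F (f a).
Proof.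
move=> fI; rewrite (eq_bigl (mem (f @: [set: A]))); last first.
  by move=> b; apply/codomP/imsetP => [[a ->]|[a _ ->]]; exists a; rewrite ?inE.
by rewrite big_imset => [|x y _ _ /fI]; [under eq_bigl do rewrite inE | ].
Qed.

(** Let v be the vector of E pushed forward to S, and h that of S.  Then
    2 v <= neighbor_sum v, with equality if only the arrows of E are counted, and
    both sides have the same pairing with h since h is harmonic; as h > 0, v is
    harmonic on S.
    A nonnegative harmonic vector on a connected quiver vanishing at one vertex
    is zero; this applies to h - v, which vanishes where h = 1, since there
    0 < v <= 1. *)
Lemma euclidean_antichain (E S : quiver_setting) :
  euclidean_props (@qs_dim E) -> euclidean_props (@qs_dim S) ->
  qs_le E S -> qs_le S E.
Proof.
move=> [hE _ posE [e0 _]] [hS cS posS [s0 s01]] [f0 [f1 [fm i0 i1 le_d]]].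
pose v y := \sum_x (f0 x == y) * qs_dim x.
have v_im x : v (f0 x) = qs_dim x.
  rewrite /v (bigD1 x) //= eqxx mul1n big1 ?addn0 // => z zx.
  by rewrite (inj_eq i0) (negbTE zx).
have v_out y : y \notin codom f0 -> v y = 0.
  move=> y_out; rewrite /v big1 // => x _.
  by case: eqP => // E'; rewrite -E' codom_f in y_out.
have le_v y : v y <= qs_dim y.
  have [/codomP[x ->]|/v_out-> //] := boolP (y \in codom f0).
  by rewrite v_im.
pose term y a := (src a == y) * v (tgt a) + (tgt a == y) * v (src a).
have nsum_im x : \sum_(a in codom f1) term (f0 x) a = 2 * v (f0 x).
  rewrite v_im -hE /neighbor_sum.
  rewrite sum_codom //; apply: eq_bigr => a _.
  by have [s t] := fm a; rewrite /term s t !(inj_eq i0) !v_im.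
have sub_harm y : 2 * v y <= neighbor_sum v y.
  have [/codomP[x ->]|/v_out-> //] := boolP (y \in codom f0).
  rewrite -nsum_im /neighbor_sum [X in _ <= X](bigID (mem (codom f1))) /=; exact: leq_addr.
have harm y : neighbor_sum v y = 2 * v y.
  have tot : \sum_y qs_dim y * neighbor_sum v y = \sum_y qs_dim y * (2 * v y).
    rewrite sum_mul_neighbor_sumC; apply: eq_bigr => z _; rewrite hS; ring.
  have := leqif_sum (P := xpredT) (fun y _ => leqif_eq (leq_mul (leqnn (qs_dim y)) (sub_harm y))).
  rewrite tot => /leqif_refl /forallP/(_ y) /=.
  by rewrite eqn_pmul2l // => /eqP.
pose w y := qs_dim y - v y.
have wharm y : neighbor_sum w y = 2 * w y.
  have : neighbor_sum w y + neighbor_sum v y = neighbor_sum (@qs_dim S) y.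
    rewrite /neighbor_sum -big_split; apply: eq_bigr => a _ /=.
    rewrite /w; have := le_v (tgt a); have := le_v (src a); move=> h1 h2.
    by rewrite addnACA -!mulnDr !subnK.
  rewrite hS harm /w; have := le_v y; lia.
have zero_closed (u : vertex S -> nat) : (forall y, neighbor_sum u y = 2 * u y) ->
    forall y0, u y0 = 0 -> forall y, u y = 0.
  move=> hu.
  have step a : (u (src a) == 0) = (u (tgt a) == 0).
    apply/idP/idP => /eqP z.
    - have := hu (src a); rewrite z muln0 /neighbor_sum => /eqP.
      rewrite sum_nat_eq0 => /forallP/(_ a) /=.
      by rewrite eqxx mul1n addn_eq0 => /andP[].
    - have := hu (tgt a); rewrite z muln0 /neighbor_sum => /eqP.
      rewrite sum_nat_eq0 => /forallP/(_ a) /=.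
      by rewrite eqxx mul1n addn_eq0 => /andP[].
  by move=> y0 /eqP z y; apply/eqP; rewrite (cS (fun y => u y == 0) step y y0).
have v0 y : 0 < v y.
  rewrite lt0n; apply/eqP => /(zero_closed _ harm)/(_ (f0 e0)).
  by rewrite v_im => z; have := posE e0; rewrite z.
have vd y : v y = qs_dim y.
  apply/eqP; rewrite eqn_leq le_v -subn_eq0; apply/eqP.
  apply: (zero_closed w wharm s0); have := v0 s0; rewrite /w s01; lia.
have f0_surj y : y \in codom f0.
  by apply: contraTT (v0 y) => /v_out ->.
(* The arrows coming from E already exhaust the neighbor sum at every vertex. *)
have f1_surj a : a \in codom f1.
  apply/negPn/negP => a_out; have /codomP[x xE] := f0_surj (src a).
  have := harm (f0 x); rewrite -nsum_im /neighbor_sum [X in X = _](bigID (mem (codom f1))) /=.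
  rewrite -[RHS]addn0 => /addnI/eqP; rewrite sum_nat_eq0 => /forall_inP/(_ a a_out).
  rewrite xE eqxx mul1n addn_eq0 => /andP[/eqP z _].
  by have := v0 (tgt a); rewrite z.
exists (fun y => iinv (f0_surj y)), (fun a => iinv (f1_surj a)); split.
- move=> a; split; apply: i0; rewrite f_iinv; have [s t] := fm (iinv (f1_surj a)).
    by rewrite -s f_iinv.
  by rewrite -t f_iinv.
- by move=> x y /(congr1 f0); rewrite !f_iinv.
- by move=> x y /(congr1 f1); rewrite !f_iinv.
- by move=> y; rewrite -v_im f_iinv vd.
Qed.

(** The orientation of the Euclidean quiver is pulled back along the embedding of
    its graph: the test st tells whether an arrow points from tail to head. *)
Lemma euclidean_of_embedding (Q : quiver) (d : vertex Q -> nat) T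
    (fV : gvertex (euclidean_graph T) -> vertex Q)
    (fE : gedge (euclidean_graph T) -> arrow Q) :
  injective fV -> injective fE ->
  (forall e, [set src (fE e); tgt (fE e)] = [set fV (edge_tail e); fV (edge_head e)]) ->
  (forall x, hvec x <= d (fV x)) ->
  exists E, euclidean_setting E /\ qs_le E (QuiverSetting d).
Proof.
move=> iV iE fEE le_d.
pose st e := src (fE e) == fV (edge_tail e).
pose s e := if st e then edge_tail e else edge_head e.
pose t e := if st e then edge_head e else edge_tail e.
exists (@QuiverSetting (Quiver s t) (@hvec T)); split.
  exists T, id, id; split=> //; split; [by exists id | by exists id |].
  move=> e /=; rewrite imset_id ends_tail_head /s /t.
  by case: (st e) => //; rewrite finset.setUC.
exists fV, fE; split=> // e /=; rewrite /s /t /st.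
have [[-> ->]|[-> ->]] := set2_inj (fEE e); first by rewrite eqxx.
by case: eqP => [->|].
Qed.

(** Injections both ways between finite sets are bijections, and then the total
    dimensions agree, so the vectors do. *)
Lemma euclidean_setting_equiv (E S : quiver_setting) :
  qs_le E S -> qs_le S E -> euclidean_setting E -> euclidean_setting S.
Proof.
move=> [f0 [f1 [fm f0i f1i fd]]] [g0 [g1 [gm g0i g1i gd]]] [T [fV [fE [[bV bE endsE] dE]]]].
have b0 : bijective f0 by apply: inj_card_bij f0i _; exact: leq_card g0i.
have b1 : bijective f1 by apply: inj_card_bij f1i _; exact: leq_card g1i.
have bg0 : bijective g0 by apply: inj_card_bij g0i _; exact: leq_card f0i.
have deq : forall x, qs_dim x = qs_dim (f0 x).
  apply: (total_dim_leq_eq (d := fun x => qs_dim (f0 x))) => //.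
  rewrite /total_dim; have <- : \sum_(y : vertex S) qs_dim y = \sum_x qs_dim (f0 x).
    by apply: reindex; exact: onW_bij.
  rewrite [X in _ <= X](reindex g0) /=; last exact: onW_bij.
  by apply: leq_sum => y _.
have [h0 f0K h0K] := b0; have [h1 f1K h1K] := b1.
exists T, (fV \o h0), (fE \o h1); split.
  split.
  - by apply: bij_comp => //; exists f0.
  - by apply: bij_comp => //; exists f1.
  - move=> a; rewrite /= endsE /= !imsetU1 !imset_set1 /=.
    have [] := fm (h1 a); rewrite h1K => -> ->.
    by rewrite !f0K.
by move=> y; rewrite -[in LHS](h0K y) -deq dE.
Qed.

(** * Nonbacktracking walks in acyclic graphs *)

Lemma exists_two_others (V : eqType) (s : seq V) x : uniq s -> 2 < size s ->
  exists a b, [/\ a \in s, b \in s, a != b, a != x & b != x].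
Proof.
case: s => [|a [|b [|c s]]] //= /and3P[]; rewrite !inE !negb_or => /and3P[ab ac _] /andP[bc _] _ _.
have [ax|ax] := eqVneq a x.
  exists b, c; rewrite !inE !eqxx !orbT bc -ax eq_sym ab; split=> //.
  by rewrite eq_sym.
have [bx|bx] := eqVneq b x.
  exists a, c; rewrite !inE !eqxx !orbT ac ax; split=> //.
  by rewrite -bx eq_sym.
by exists a, b; rewrite !inE !eqxx !orbT ab.
Qed.

Lemma big_pair (V : eqType) (s : seq V) a b (F : V -> nat) : uniq s -> size s = 2 ->
  a \in s -> b \in s -> a != b -> \sum_(y <- s) F y = F a + F b.
Proof.
case: s => [|x [|y [|z s]]] //= _ _; rewrite !inE big_cons big_seq1.
by move=> /orP[]/eqP-> /orP[]/eqP->; rewrite ?eqxx // addnC.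
Qed.

Section Graph.
Variables (V : finType) (r : rel V).
Hypotheses (r_sym : symmetric r) (r_irr : irreflexive r).

(** Cycles of length 2 go back and forth along one edge. *)
Definition acyclic : Prop := forall c, cycle r c -> uniq c -> size c <= 2.

(** Walks that never return immediately to the previous vertex. *)
Fixpoint nbwalk (s : seq V) : bool :=
  match s with
  | x :: s' => match s' with
     | y :: t => [&& r x y, ohead t != Some x & nbwalk s']
     | [::] => true
     end
  | [::] => true
  end.

Lemma nbwalk_path x s : nbwalk (x :: s) -> path r x s.
Proof. by elim: s x => //= y s IHs x /and3P[-> _ /IHs]. Qed.

(** A first return would close a cycle, of length at least 3 for want of
    backtracking. *)
Lemma nbwalk_uniq s : acyclic -> nbwalk s -> uniq s.
Proof.
move=> acyc; elim: s => // u [|v s] IHs // nb.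
have /and3P[ruv us nb'] := nb; have us' := IHs nb'.
have path_uv := nbwalk_path nb.
rewrite cons_uniq us' andbT inE negb_or.
apply/andP; split; first by apply: contraTneq ruv => ->; rewrite r_irr.
apply/negP => u_s; case/splitPr: u_s path_uv us us' {nb nb' IHs} => p1 p2.
rewrite -cat_cons cat_path => /andP[p1P] /andP[lu _] us; rewrite cat_uniq.
move=> /and3P[u1] /norP[u_p1 _] _.
have := acyc (u :: v :: p1); rewrite /= rcons_path.
move: p1P => /= /andP[_ ->]; rewrite ruv lu.
move: u1 => /= /andP[-> ->]; rewrite u_p1 => /(_ isT isT).
by case: p1 us {lu u_p1} => //=; rewrite eqxx.
Qed.

(** Two walks leaving x by different edges join to one walk through x. *)
Lemma nbwalk_catrev x s1 s2 : nbwalk (x :: s1) -> nbwalk (x :: s2) ->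
  (if s1 is y :: _ then ohead s2 != Some y else true) -> nbwalk (catrev s1 (x :: s2)).
Proof.
elim: s1 x s2 => //= y s1 IHs x s2 /and3P[rxy s1x nb1] nb2 ys2.
apply: IHs => //.
  by rewrite /= r_sym rxy ys2.
by case: s1 s1x {nb1} => //= z s1; rewrite !(inj_eq Some_inj) eq_sym.
Qed.

Lemma nbwalk_rev s : nbwalk s -> nbwalk (rev s).
Proof.
case: s => // x s nb; rewrite /rev /=.
by have := @nbwalk_catrev x s [::] nb; apply=> //; case: s nb.
Qed.

Definition nbrs x := [seq y <- enum V | r x y].

Lemma mem_nbrs x y : (y \in nbrs x) = r x y.
Proof. by rewrite mem_filter mem_enum andbT. Qed.

Lemma nbrs_uniq x : uniq (nbrs x).
Proof. by rewrite filter_uniq // enum_uniq. Qed.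

Lemma walk_or_long n u v : r u v ->
  (exists p, [/\ nbwalk (u :: v :: p), (forall x, x \in belast v p -> size (nbrs x) = 2)
                & size (nbrs (last v p)) <> 2]) \/
  (exists p, nbwalk (u :: v :: p) /\ size p = n).
Proof.
elim: n u v => [|n IHn] u v ruv; first by right; exists [::]; rewrite /= ruv.
have [v2|v2] := eqVneq (size (nbrs v)) 2; last first.
  by left; exists [::]; split; rewrite //= ?ruv //; apply/eqP.
have [w wv wu] : exists2 w, r v w & w != u.
  have uv : u \in nbrs v by rewrite mem_nbrs r_sym.
  move: v2 uv (nbrs_uniq v) (mem_nbrs v).
  case: (nbrs v) => [|a [|b []]] //= _; rewrite !inE andbT => uab ab mem.
  have [ua|ua] := eqVneq u a.
    by exists b; [rewrite -mem !inE eqxx orbT | rewrite ua eq_sym].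
  exists a; first by rewrite -mem !inE eqxx.
  by rewrite eq_sym.
have [[p [nb p2 pl]]|[p [nb pn]]] := IHn v w wv; [left|right]; exists (w :: p); split=> //.
- by move: nb => /=; rewrite ruv (inj_eq Some_inj) wu => ->.
- by move=> x /=; rewrite inE => /orP[/eqP->|/p2].
- by move: nb => /=; rewrite ruv (inj_eq Some_inj) wu => ->.
- by rewrite /= pn.
Qed.

(** A walk is continued, without choice, through vertices of degree 2; being
    without repetition, it stops. *)
Lemma walk_to_end u v : acyclic -> r u v ->
  exists p, [/\ nbwalk (u :: v :: p), (forall x, x \in belast v p -> size (nbrs x) = 2)
                & size (nbrs (last v p)) <> 2].
Proof.
move=> acyc ruv; have [//|[p [nb pn]]] := walk_or_long #|V| ruv.
have /card_uniqP E := nbwalk_uniq acyc nb.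
by have := max_card (mem (u :: v :: p)); rewrite E /= pn; rewrite ltnNge leqnSn.
Qed.

Variable d : V -> nat.
Hypothesis r_gt0 : forall x y, r x y -> 0 < d x.

(** Copies of the Euclidean graph T, with its vector below d.  For graphs without
    loops and multiple edges, the images of the edges need not be specified. *)
Definition hosts T : Prop :=
  exists fV : gvertex (euclidean_graph T) -> V,
    [/\ injective fV, (forall e, r (fV (edge_tail e)) (fV (edge_head e)))
      & forall x, hvec x <= d (fV x)].

Lemma hosts_cycle c : cycle r c -> uniq c -> 2 < size c -> exists n, 2 <= n /\ hosts (EuclA n).
Proof.
case: c => // x0 c cyc un sz; exists (size c); split=> //.
have rnth (i : 'I_(size c).+1) : r (nth x0 (x0 :: c) i) (nth x0 (x0 :: c) (ordS i)).
  have /= /(pathP x0)/(_ i) := cyc; rewrite size_rcons ltn_ord => /(_ isT).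
  rewrite -rcons_cons nth_rcons /= ltn_ord nth_rcons.
  have [lt|ge] := ltnP i (size c); first by rewrite modn_small.
  have -> : i = size c :> nat by apply/eqP; rewrite eqn_leq ge -ltnS ltn_ord.
  by rewrite eqxx modnn.
exists (fun i : 'I_(size c).+1 => nth x0 (x0 :: c) i); split=> //.
  by move=> i j /eqP; rewrite nth_uniq //= ?ltn_ord // => /eqP /val_inj.
by move=> i /=; exact: r_gt0 (rnth i).
Qed.

Lemma hosts_fork m c (l : bool * bool -> V) x0 : size c = m.+1 ->
  uniq (c ++ [:: l (false, false); l (false, true); l (true, false); l (true, true)]) ->
  (forall i, i < m -> r (nth x0 c i) (nth x0 c i.+1)) ->
  (forall b, r (nth x0 c 0) (l (false, b))) -> (forall b, r (nth x0 c m) (l (true, b))) ->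
  (forall x, x \in c -> 2 <= d x) -> hosts (EuclD m).
Proof.
move=> sz; rewrite cat_uniq => /and3P[uc disj ul] pc l0 lm d2.
have lI : injective l.
  move: ul; rewrite /= !inE !negb_or => /and4P[/and3P[n1 n2 n3] /andP[n4 n5] n6 _].
  by move=> [[] []] [[] []] E //; move: n1 n2 n3 n4 n5 n6; rewrite ?E ?eqxx //= -?E ?eqxx.
have l_out p : l p \notin c.
  apply: contra disj => lc; apply/hasP; exists (l p) => //.
  by case: p {lc} => [[] []]; rewrite !inE eqxx ?orbT.
exists (fun x => match x with inl i => nth x0 c (i : 'I_m.+1) | inr p => l p end); split.
- move=> [i|p] [j|q] /=.
  + by move=> /eqP; rewrite nth_uniq ?sz ?ltn_ord // => /eqP/val_inj->.
  + by move=> E; have := l_out q; rewrite -E mem_nth // sz.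
  + by move=> E; have := l_out p; rewrite E mem_nth // sz.
  + by move=> /lI->.
- by move=> [i|[[] b]] //=; exact: pc.
- move=> [i|[e b]] /=; first by rewrite d2 // mem_nth // sz.
  by case: e; [have := lm b | have := l0 b]; rewrite r_sym; exact: r_gt0.
Qed.

Lemma hosts_tree (p w : seq nat) (l : seq V) x0 : size l = (size p).+1 -> uniq l ->
  all (fun i => nth 0 p i <= i) (iota 0 (size p)) ->
  all (fun i => r (nth x0 l (nth 0 p i)) (nth x0 l i.+1)) (iota 0 (size p)) ->
  all (fun i => nth 0 w i <= d (nth x0 l i)) (iota 0 (size p).+1) ->
  exists fV : 'I_(size p).+1 -> V,
    [/\ injective fV, (forall e, r (fV (@tree_parent p e)) (fV (lift ord0 e)))
      & forall x : 'I_(size p).+1, nth 0 w x <= d (fV x)].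
Proof.
move=> sz ul /allP ple /allP rl /allP wl; exists (fun i : 'I_(size p).+1 => nth x0 l i); split.
- by move=> i j /eqP; rewrite nth_uniq ?sz ?ltn_ord // => /eqP/val_inj.
- move=> i; have ii : (i : nat) \in iota 0 (size p) by rewrite mem_iota ltn_ord.
  rewrite /tree_parent inordK ?(rl i ii) //.
  by rewrite ltnS; apply: leq_trans (ple i ii) (ltnW _).
- by move=> x; apply: wl; rewrite mem_iota ltn_ord.
Qed.

End Graph.

(** The sequence a, b, s, followed by the value 0, is convex: the constraints of a
    subharmonic vector along an arm that ends in a leaf. *)
Fixpoint convex (a b : nat) (s : seq nat) : Prop :=
  if s is c :: s' then 2 * b <= a + c /\ convex b c s' else 2 * b <= a.

(** The first of the size s + 2 steps from a down to 0 is the largest. *)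
Lemma convex_bound a b s : convex a b s -> (size s + 2) * b <= (size s + 1) * a.
Proof. elim: s a b => [|c s IHs] a b /=; [lia | move=> [h /IHs]; nia]. Qed.

Lemma convex_lt a b s : 0 < b -> convex a b s -> b < a.
Proof. move=> b0 /convex_bound; nia. Qed.

Lemma uniq_cons_cat3 (V : eqType) (b : V) s1 s2 s3 :
  uniq (b :: s1 ++ s2) -> uniq (b :: s1 ++ s3) -> uniq (b :: s2 ++ s3) ->
  uniq (b :: s1 ++ s2 ++ s3).
Proof.
rewrite !cons_uniq !mem_cat !negb_or !cat_uniq has_cat negb_or.
move=> /andP[/andP[-> ->] /and3P[-> -> ->]] /andP[/andP[_ ->] /and3P[_ -> _]].
by move=> /andP[_ /and3P[_ -> ->]].
Qed.

(** * Acyclic graphs with a subharmonic vector *)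

Section Star.
Variables (V : finType) (r : rel V).
Hypotheses (r_sym : symmetric r) (r_irr : irreflexive r).
Variable d : V -> nat.
Hypothesis r_gt0 : forall x y, r x y -> 0 < d x.
Hypothesis acyc : acyclic r.
Notation hosts := (hosts r d).

Definition arm b y p := nbwalk r (b :: y :: p) /\ convex (d b) (d y) (map d p).

Lemma arms_uniq b y p y' p' : arm b y p -> arm b y' p' -> y != y' ->
  uniq (b :: (y :: p) ++ (y' :: p')).
Proof.
move=> [nb _] [nb' _] yy'.
have := nbwalk_uniq r_irr acyc (nbwalk_catrev r_sym nb nb' _).
rewrite (inj_eq Some_inj) eq_sym yy' => /(_ isT); rewrite catrevE.
have P : perm_eq (rev (y :: p) ++ [:: b] ++ y' :: p') ([:: b] ++ (y :: p) ++ y' :: p').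
  by rewrite perm_catCA perm_cat2l perm_cat2r perm_rev.
by rewrite (perm_uniq P).
Qed.

Lemma three_arms_uniq b y1 p1 y2 p2 y3 p3 a1 a2 a3 :
  arm b y1 p1 -> arm b y2 p2 -> arm b y3 p3 -> y1 != y2 -> y1 != y3 -> y2 != y3 ->
  uniq (b :: take a1 (y1 :: p1) ++ take a2 (y2 :: p2) ++ take a3 (y3 :: p3)).
Proof.
move=> A1 A2 A3 n12 n13 n23.
set s1 := y1 :: p1; set s2 := y2 :: p2; set s3 := y3 :: p3.
apply: (@subseq_uniq _ _ (b :: s1 ++ s2 ++ s3)).
  apply: (@cat_subseq _ [:: b] _ [:: b]); first exact: subseq_refl.
  by rewrite !cat_subseq ?take_subseq.
exact: uniq_cons_cat3 (arms_uniq A1 A2 n12) (arms_uniq A1 A3 n13) (arms_uniq A2 A3 n23).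
Qed.

Lemma nbwalk_gt0 b s : nbwalk r (b :: s) -> {in s, forall y, 0 < d y}.
Proof.
elim: s b => // x s IHs b /and3P[rbx _ nb] y; rewrite inE => /orP[/eqP->|].
  by move: rbx; rewrite r_sym; exact: r_gt0.
exact: IHs nb y.
Qed.

(** By convexity, an arm with l vertices starts with a value of at most
    l / (l + 1) times the value at the center b; the three starting values add up
    to at least twice the value at b, so the sum of the 1 / (l + 1) is at most 1.
    Hence the arms are at least as long as those of E~6, E~7 or E~8.  The values
    decrease strictly outward, and this together with the inequality at b gives
    the values required at the prescribed places. *)
Lemma star_hosts_sorted b y1 p1 y2 p2 y3 p3 :
  arm b y1 p1 -> arm b y2 p2 -> arm b y3 p3 -> y1 != y2 -> y1 != y3 -> y2 != y3 ->
  2 * d b <= d y1 + d y2 + d y3 -> size p3 <= size p2 <= size p1 ->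
  exists T, hosts T /\ (forall n, T <> EuclA n).
Proof.
move=> A1 A2 A3 n12 n13 n23 sum_b /andP[le32 le21].
have U a1 a2 a3 := three_arms_uniq a1 a2 a3 A1 A2 A3 n12 n13 n23.
move: A1 A2 A3 => [nb1 c1] [nb2 c2] [nb3 c3].
have g1 := nbwalk_gt0 nb1; have g2 := nbwalk_gt0 nb2; have g3 := nbwalk_gt0 nb3.
have B1 := convex_bound c1; have B2 := convex_bound c2; have B3 := convex_bound c3.
have L1 := convex_lt (g1 y1 (mem_head _ _)) c1.
have L2 := convex_lt (g2 y2 (mem_head _ _)) c2.
have L3 := convex_lt (g3 y3 (mem_head _ _)) c3.
have gt_in (s : seq V) : {in s, forall y, 0 < d y} -> all (fun y => 0 < d y) s.
  by move=> h; apply/allP.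
move: g1 g2 g3 => /gt_in g1 /gt_in g2 /gt_in g3 {gt_in}.
(* If all three arms have at least two vertices, they contain E~6. *)
case: p3 le32 U nb3 c3 g3 B3 L3 => [|w3 p3] le32 U nb3 c3 g3 B3 L3; last first.
  case: p2 le32 le21 U nb2 c2 g2 B2 L2 => [//|w2 p2] le32 le21 U nb2 c2 g2 B2 L2.
  case: p1 le21 U nb1 c1 g1 B1 L1 => [//|w1 p1] le21 U nb1 c1 g1 B1 L1.
  exists EuclE6; split=> //.
  move: (U 2 2 2) nb1 nb2 nb3 c1 c2 c3 g1 g2 g3; rewrite /= !take0 => U'.
  move=> /and4P[r11 _ r12 _] /and4P[r21 _ r22 _] /and4P[r31 _ r32 _].
  move=> [_ c1] [_ c2] [_ c3] /and3P[? g1 _] /and3P[? g2 _] /and3P[? g3 _].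
  apply: (@hosts_tree _ r d [:: 0; 1; 0; 3; 0; 5] [:: 3; 2; 1; 2; 1; 2; 1]
    [:: b; y1; w1; y2; w2; y3; w3] b) => //=.
    by rewrite r11 r12 r21 r22 r31 r32.
  have := convex_lt g1 c1; have := convex_lt g2 c2; have := convex_lt g3 c3.
  move: g1 g2 g3 L1 L2 L3; clear; lia.
(* Otherwise the third arm is a single vertex.  If the second one is a single vertex
   too, the inequality at b fails; if it has two vertices, the first arm needs at
   least five, which is E~8; if it has three or more, so has the first: E~7. *)
move: U nb1 nb2 nb3 c1 c2 c3 g1 g2 g3 B1 B2 L1 L2 => U.
case: p2 le32 le21 U => [|w2 [|z2 p2]] _ /= le21 U.
- move=> _ _ _ _ _ c3 _ _ _ _ B2 L1 _; exfalso.
  by move: c3 B2 L1 sum_b => /=; move: (d b) (d y1) (d y2) (d y3); clear; lia.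
- case: p1 le21 U => [//|w1 p1] _ U nb1 nb2 nb3 c1 c2 c3 g1 g2 g3 B1 B2 L1 L2.
  have [short|long] := leqP (size p1) 2.
    exfalso; move: short c3 B1 B2 L1 sum_b; rewrite /= size_map.
    move: (size p1) (d b) (d y1) (d y2) (d y3); clear.
    by case=> [|[|[|n]]] //; lia.
  case: p1 long U nb1 c1 g1 B1 L1 => [|x1 [|t1 [|q1 p1]]] // _ U nb1 c1 g1 B1 L1.
  exists EuclE8; split=> //.
  move: (U 5 2 1) nb1 nb2 nb3 c1 c2 c3 g1 g2 g3; rewrite /= !take0 => U'.
  move=> /and5P[r11 _ r12 _ /and5P[r13 _ r14 _ /andP[r15 _]]] /and4P[r21 _ r22 _].
  rewrite andbT => r31.
  move=> [c11 [c12 [c13 [c14 c15]]]] [c21 c22] c31.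
  move=> /andP[_ /andP[_ /andP[_ /andP[g14 /andP[g15 _]]]]] /and3P[g21 g22 _] /andP[g31 _].
  have {c15} := convex_lt g15 c15 => c15.
  apply: (@hosts_tree _ r d [:: 0; 1; 2; 3; 4; 0; 6; 0] [:: 6; 5; 4; 3; 2; 1; 4; 2; 3]
    [:: b; y1; w1; x1; t1; q1; y2; w2; y3] b) => //=.
    by rewrite r11 r12 r13 r14 r15 r21 r22 r31.
  move: c11 c12 c13 c14 c15 c21 c22 c31 g15 g22 g31 sum_b; clear; lia.
case: p1 le21 U => [|w1 [|x1 p1]] //= _ U nb1 nb2 nb3 c1 c2 c3 g1 g2 g3 B1 B2 L1 L2.
exists EuclE7; split=> //.
move: (U 3 3 1) nb1 nb2 nb3 c1 c2 c3 g1 g2 g3; rewrite /= !take0 => U'.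
move=> /and5P[r11 _ r12 _ /andP[r13 _]] /and5P[r21 _ r22 _ /andP[r23 _]].
rewrite andbT => r31.
move=> [c11 [c12 c13]] [c21 [c22 c23]] c31.
move=> /and4P[_ _ g13 _] /and4P[_ _ g23 _] /andP[g31 _].
have {c13} := convex_lt g13 c13 => c13; have {c23} := convex_lt g23 c23 => c23.
apply: (@hosts_tree _ r d [:: 0; 1; 2; 0; 4; 5; 0] [:: 4; 3; 2; 1; 3; 2; 1; 2]
  [:: b; y1; w1; x1; y2; w2; z2; y3] b) => //=.
  by rewrite r11 r12 r13 r21 r22 r23 r31.
move: c11 c12 c13 c21 c22 c23 c31 g13 g23 g31 sum_b; clear; lia.
Qed.

Lemma star_hosts b y1 p1 y2 p2 y3 p3 :
  arm b y1 p1 -> arm b y2 p2 -> arm b y3 p3 -> y1 != y2 -> y1 != y3 -> y2 != y3 ->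
  2 * d b <= d y1 + d y2 + d y3 ->
  exists T, hosts T /\ (forall n, T <> EuclA n).
Proof.
move=> A1 A2 A3 n12 n13 n23 le_b.
have n21 : y2 != y1 by rewrite eq_sym. have n31 : y3 != y1 by rewrite eq_sym.
have n32 : y3 != y2 by rewrite eq_sym.
case: (leqP (size p1) (size p2)) => l12; case: (leqP (size p2) (size p3)) => l23;
  case: (leqP (size p1) (size p3)) => l13; try lia.
- by apply: (star_hosts_sorted A3 A2 A1) => //; lia.
- by apply: (star_hosts_sorted A2 A3 A1) => //; lia.
- by apply: (star_hosts_sorted A2 A1 A3) => //; lia.
- by apply: (star_hosts_sorted A3 A1 A2) => //; lia.
- by apply: (star_hosts_sorted A1 A3 A2) => //; lia.
- by apply: (star_hosts_sorted A1 A2 A3) => //; lia.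
Qed.

Hypothesis ge2 : forall x, 2 <= size (nbrs r x) -> 2 <= d x.

(** Each end of the walk from b to z has two more neighbors, besides the one on the
    walk; prolonging the walk to one of them at either end keeps it
    nonbacktracking, so that all these vertices are distinct. *)
Lemma hosts_of_two_branches b v p : 3 <= size (nbrs r b) -> nbwalk r (b :: v :: p) ->
  (forall x, x \in belast v p -> size (nbrs r x) = 2) ->
  3 <= size (nbrs r (last v p)) -> hosts (EuclD (size p).+1).
Proof.
move=> b3 nb p2 z3; set z := last v p in z3.
have [u1 [u2 [u1b u2b u12 u1v u2v]]] := exists_two_others v (nbrs_uniq r b) b3.
pose prev := last b (belast v p).
have [v1 [v2 [v1z v2z v12 v1p v2p]]] := exists_two_others prev (nbrs_uniq r z) z3.
move: u1b u2b v1z v2z; rewrite !mem_nbrs => u1b u2b v1z v2z.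
have cE : b :: v :: p = rcons (rcons (belast b (belast v p)) prev) z.
  by rewrite -lastI rcons_cons -lastI.
have ext u w : r b u -> u != v -> r z w -> w != prev -> uniq (w :: rev (u :: b :: v :: p)).
  move=> bu uv zw wp; apply: (nbwalk_uniq r_irr acyc).
  have nbu : nbwalk r (u :: b :: v :: p).
    by move: nb => /= ->; rewrite r_sym bu (inj_eq Some_inj) eq_sym uv.
  have := nbwalk_rev r_sym nbu; rewrite cE -rcons_cons rev_rcons -rcons_cons rev_rcons /=.
  by move=> ->; rewrite r_sym zw (inj_eq Some_inj) eq_sym wp.
have ext' u w : r b u -> u != v -> r z w -> w != prev ->
    [/\ uniq (b :: v :: p), u \notin b :: v :: p, w \notin b :: v :: p & u != w].
  move=> bu uv zw wp; have := ext u w bu uv zw wp.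
  rewrite cons_uniq rev_uniq mem_rev cons_uniq inE negb_or eq_sym.
  by move=> /andP[/andP[-> ->] /andP[-> ->]].
have [uc n1 m1 e11] := ext' _ _ u1b u1v v1z v1p.
have [_ n2 m2 e22] := ext' _ _ u2b u2v v2z v2p.
have [_ _ _ e12] := ext' _ _ u1b u1v v2z v2p.
have [_ _ _ e21] := ext' _ _ u2b u2v v1z v1p.
pose l (x : bool * bool) := if x.1 then (if x.2 then v2 else v1) else (if x.2 then u2 else u1).
apply: (@hosts_fork _ r r_sym d r_gt0 _ (b :: v :: p) l b) => //.
- move: (b :: v :: p) uc n1 n2 m1 m2 => c uc n1 n2 m1 m2.
  by rewrite cat_uniq uc /= !inE !negb_or n1 n2 m1 m2 u12 e11 e12 e21 e22 v12.
- move=> i lt_i; have /(pathP b)/(_ i) := nbwalk_path nb; exact.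
- by case.
- by move=> []; rewrite /= nth_last.
- move=> x; rewrite inE => /orP[/eqP->|]; first by apply: ge2; exact: ltnW.
  rewrite lastI mem_rcons inE => /orP[/eqP->|/p2 x2]; first by apply: ge2; exact: ltnW.
  by apply: ge2; rewrite x2.
Qed.

Lemma hosts_of_four_neighbors b : 4 <= size (nbrs r b) -> hosts (EuclD 0).
Proof.
move=> b4; have b2 : 2 <= d b by apply: ge2; apply: leq_trans b4.
have mem x := mem_nbrs r b x; have un := nbrs_uniq r b; move: b4 un mem.
case: (nbrs r b) => [|x1 [|x2 [|x3 [|x4 s]]]] //= _ un mem.
have [m1 m2 m3 m4] : [/\ r b x1, r b x2, r b x3 & r b x4].
  by rewrite -!mem !inE !eqxx !orbT.
pose l (x : bool * bool) := if x.1 then (if x.2 then x4 else x3) else (if x.2 then x2 else x1).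
apply: (@hosts_fork _ r r_sym d r_gt0 _ [:: b] l b) => //.
- have bx x : r b x -> b != x by apply: contraTneq => ->; rewrite r_irr.
  move: un; rewrite /= !inE !negb_or => /and5P[/and4P[-> -> -> _] /and3P[-> -> _] /andP[-> _] _ _].
  by rewrite !bx.
- by case.
- by case.
- by move=> x; rewrite inE => /eqP->.
Qed.

Hypothesis subharmonic : forall x, 0 < d x -> 2 * d x <= \sum_(y <- nbrs r x) d y.

Lemma arm_of_walk u v p : nbwalk r (u :: v :: p) ->
  (forall x, x \in belast v p -> size (nbrs r x) = 2) -> size (nbrs r (last v p)) = 1 ->
  arm u v p.
Proof.
move=> nb p2 z1; split=> //.
elim: p u v nb p2 z1 => [|w p IHp] u v nb p2 z1 /=.
  have /andP[ruv _] := nb.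
  have := subharmonic (r_gt0 (x := v) (y := u) _); rewrite r_sym => /(_ ruv).
  have : u \in nbrs r v by rewrite mem_nbrs r_sym.
  by case: (nbrs r v) z1 => [|a []] //= _; rewrite inE big_seq1 => /eqP->.
have /and3P[ruv wu nb'] := nb; have /andP[rvw _] := nb'.
split; last by apply: IHp => // x xp; apply: p2; rewrite inE xp orbT.
have v2 : size (nbrs r v) = 2 by apply: p2; rewrite inE eqxx.
have := subharmonic (r_gt0 rvw).
rewrite (@big_pair _ _ u w) ?nbrs_uniq ?mem_nbrs // 1?r_sym //.
by move: wu; rewrite /= (inj_eq Some_inj) eq_sym.
Qed.

Lemma nbrs_nonempty x : 0 < d x -> exists y, r x y.
Proof.
move=> dx; have := subharmonic dx; have := mem_nbrs r x.
case: (nbrs r x) => [|y s] mem; first by rewrite big_nil; lia.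
by move=> _; exists y; rewrite -mem inE eqxx.
Qed.

Lemma size_nbrs_gt0 x y : r x y -> 0 < size (nbrs r x).
Proof. by rewrite -mem_nbrs; case: (nbrs r x). Qed.

Lemma walk_alternative u v : r u v ->
  (exists p, arm u v p) \/
  (exists p, [/\ nbwalk r (u :: v :: p), (forall x, x \in belast v p -> size (nbrs r x) = 2)
      & 3 <= size (nbrs r (last v p))]).
Proof.
move=> ruv; have [p [nb p2 z2]] := walk_to_end r_sym r_irr acyc ruv.
have z0 : 0 < size (nbrs r (last v p)).
  case/lastP: p nb {p2 z2} => [|p w] nb /=; first by apply: (@size_nbrs_gt0 _ u); rewrite r_sym.
  have := nbwalk_path nb; rewrite last_rcons /= rcons_path => /and3P[_ _ h].
  by apply: (@size_nbrs_gt0 _ (last v p)); rewrite r_sym.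
have [z1|z1] := eqVneq (size (nbrs r (last v p))) 1.
  by left; exists p; exact: arm_of_walk.
right; exists p; split=> //; move: z0 z1 z2; lia.
Qed.

(** Otherwise, for an edge between x and y, the walk from x through y and the walk
    from y through x would both end in leaves, giving d y < d x and d x < d y. *)
Lemma exists_branch : (exists x, 0 < d x) -> exists b, 3 <= size (nbrs r b).
Proof.
move=> [x dx]; have [y rxy] := nbrs_nonempty dx.
have ryx : r y x by rewrite r_sym.
have [[p [_ cp]]|[p [_ _ h]]] := walk_alternative rxy; last by eexists; exact: h.
have [[q [_ cq]]|[q [_ _ h]]] := walk_alternative ryx; last by eexists; exact: h.
by have := convex_lt (r_gt0 rxy) cq; have := convex_lt (r_gt0 ryx) cp; lia.
Qed.

(** From a branch vertex b of degree 3, each of the three walks either meets a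
    second branch vertex or is an arm. *)
Lemma acyclic_hosts : (exists x, 0 < d x) -> exists T, hosts T /\ (forall n, T <> EuclA n).
Proof.
move=> /exists_branch[b b3].
have [b4|b3'] := ltnP 3 (size (nbrs r b)).
  by exists (EuclD 0); split=> //; exact: hosts_of_four_neighbors b4.
have [y1 [y2 [y3 E]]] : exists y1 y2 y3, nbrs r b = [:: y1; y2; y3].
  by case: (nbrs r b) b3 b3' => [|y1 [|y2 [|y3 []]]] //; exists y1, y2, y3.
have := nbrs_uniq r b; rewrite E /= !inE !negb_or => /and3P[/andP[n12 n13] n23 _].
have [r1 r2 r3] : [/\ r b y1, r b y2 & r b y3] by rewrite -!mem_nbrs E !inE !eqxx !orbT.
have alt y : r b y -> (exists p, arm b y p) \/ exists T, hosts T /\ (forall n, T <> EuclA n).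
  move=> /walk_alternative[|[p [nb p2 z3]]]; [by left | right].
  by exists (EuclD (size p).+1); split=> //; exact: hosts_of_two_branches b3 nb p2 z3.
have [[p1 A1]|//] := alt y1 r1; have [[p2 A2]|//] := alt y2 r2; have [[p3 A3]|//] := alt y3 r3.
apply: (star_hosts A1 A2 A3) => //.
have := subharmonic (r_gt0 r1); rewrite E !big_cons big_nil; lia.
Qed.

End Star.

(** * Minimal dimension vectors with nonpositive Tits form *)

(** Euclidean graphs other than A~0 and A~1 have no parallel edges. *)
Lemma edge_ends_inj T (e e' : gedge (euclidean_graph T)) :
  (forall n, T = EuclA n -> 2 <= n) ->
  (edge_tail e = edge_tail e' /\ edge_head e = edge_head e') \/
  (edge_tail e = edge_head e' /\ edge_head e = edge_tail e') -> e = e'.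
Proof.
have tree p (i j : 'I_(size p)) : all (fun i => nth 0 p i <= i) (iota 0 (size p)) ->
    (@tree_parent p i = tree_parent j /\ lift ord0 i = lift ord0 j) \/
    (tree_parent i = lift ord0 j /\ lift ord0 i = tree_parent j) -> i = j.
  move=> /allP ple [[_ /lift_inj//]|[/(congr1 val)/= E1 /(congr1 val)/= E2]].
  have pi (l : 'I_(size p)) : nth 0 p l <= l by apply: ple; rewrite mem_iota ltn_ord.
  have ti (l : 'I_(size p)) : val (tree_parent l) <= l.
    by rewrite /tree_parent /= inordK ?pi // ltnS; apply: leq_trans (pi l) (ltnW _).
  have := ti i; have := ti j; move: E1 E2; rewrite /= /bump /=; lia.
case: T e e' => [n|m|||] /= e e' hn.
- move=> [[]//|[/(congr1 val)/= E1 /(congr1 val)/= E2]]; apply: val_inj => /=.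
  have n2 := hn n erefl; have := ltn_ord e; have := ltn_ord e'.
  move: E1 E2; have [lt|ge] := ltnP e n; have [lt'|ge'] := ltnP e' n.
  + by rewrite !modn_small ?ltnS //; lia.
  + have -> : e' = n :> nat by apply/eqP; rewrite eqn_leq ge' -ltnS ltn_ord.
    by rewrite modnn modn_small ?ltnS //; lia.
  + have -> : e = n :> nat by apply/eqP; rewrite eqn_leq ge -ltnS ltn_ord.
    by rewrite modnn modn_small ?ltnS //; lia.
  + lia.
- case: e e' => [i|[a b]] [j|[a' b']] /=.
  + case=> [[_ E]|[E1 E2]]; first by rewrite (lift_inj (inl_inj E)).
    have := congr1 val (inl_inj E1); have := congr1 val (inl_inj E2).
    by rewrite /= /bump /=; lia.
  + by case=> [[]//|[]//].
  + by case=> [[]//|[]//].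
  + by case=> [[_ E]|[]//]; rewrite (inr_inj E).
- exact: (tree [:: 0; 1; 0; 3; 0; 5]).
- exact: (tree [:: 0; 1; 2; 0; 4; 5; 0]).
- exact: (tree [:: 0; 1; 2; 3; 4; 0; 6; 0]).
Qed.

Section MinimalDimension.
Variable Q : quiver.
Implicit Types d : vertex Q -> nat.

Definition contains_euclidean d :=
  exists E, euclidean_setting E /\ qs_le E (QuiverSetting d).

Lemma contains_euclidean_mono d d' : (forall x, d' x <= d x) ->
  contains_euclidean d' -> contains_euclidean d.
Proof.
move=> le_d [E [eE [f0 [f1 [fm i0 i1 fd]]]]]; exists E; split=> //.
by exists f0, f1; split=> // x; apply: leq_trans (fd x) (le_d _).
Qed.

Lemma contains_euclidean_of_loop d a : src a = tgt a -> 0 < d (src a) -> contains_euclidean d.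
Proof.
move=> st da.
apply: (@euclidean_of_embedding Q d (EuclA 0) (fun=> src a) (fun=> a)) => //.
- by move=> x y _; rewrite !ord1.
- by move=> x y _; rewrite !ord1.
- by move=> e; rewrite -st.
Qed.

Lemma contains_euclidean_of_parallel d a b : a != b -> src a != tgt a ->
  [set src a; tgt a] = [set src b; tgt b] -> 0 < d (src a) -> 0 < d (tgt a) ->
  contains_euclidean d.
Proof.
move=> ab st ends ds dt.
apply: (@euclidean_of_embedding Q d (EuclA 1) (fun i : 'I_2 => if i == ord0 then src a else tgt a)
   (fun i : 'I_2 => if i == ord0 then a else b)).
- move=> [[|[|//]] ?] [[|[|//]] ?] /= E; try exact: val_inj; by rewrite E eqxx in st.
- move=> [[|[|//]] ?] [[|[|//]] ?] /= E; try exact: val_inj; by rewrite E eqxx in ab.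
- by move=> [[|[|//]] ?] //=; rewrite -ends finset.setUC.
- by move=> [[|[|//]] ?].
Qed.

Variable d : vertex Q -> nat.
Hypothesis no_loop : forall a, 0 < d (src a) -> src a != tgt a.
Hypothesis no_parallel : forall a b, [set src a; tgt a] = [set src b; tgt b] ->
  0 < d (src a) -> 0 < d (tgt a) -> a = b.
Hypothesis d_neg : dim_group d <= dim_rep d.
Hypothesis d_min : forall d', (forall x, d' x <= d x) -> (exists x, 0 < d' x) ->
  total_dim d' < total_dim d -> dim_rep d' < dim_group d'.

Definition link (a : arrow Q) x y :=
  ((src a == x) && (tgt a == y)) || ((src a == y) && (tgt a == x)).
Definition adj : rel (vertex Q) := fun x y => [&& 0 < d x, 0 < d y & [exists a, link a x y]].

Lemma adj_sym : symmetric adj.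
Proof.
by move=> x y; rewrite /adj andbCA; congr [&& _, _ & _]; apply: eq_existsb => a; rewrite /link orbC.
Qed.

Lemma adj_irr : irreflexive adj.
Proof.
move=> x; apply/negP => /and3P[dx _ /existsP[a]]; rewrite /link orbb => /andP[/eqP s /eqP t].
by have := no_loop (a := a); rewrite s t eqxx => /(_ dx).
Qed.

Lemma adj_gt0 x y : adj x y -> 0 < d x.
Proof. by case/and3P. Qed.

Lemma adj_arrow a : 0 < d (src a) -> 0 < d (tgt a) -> adj (src a) (tgt a).
Proof. by move=> ds dt; rewrite /adj ds dt; apply/existsP; exists a; rewrite /link !eqxx. Qed.

Lemma contains_euclidean_of_hosts T :
  (forall n, T = EuclA n -> 2 <= n) -> hosts adj d T -> contains_euclidean d.
Proof.
move=> hT [fV [iV rV dV]].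
have /choice[fE fEP] : forall e, exists a, link a (fV (edge_tail e)) (fV (edge_head e)).
  by move=> e; have /and3P[_ _ /existsP] := rV e.
have ends e : [set src (fE e); tgt (fE e)] = [set fV (edge_tail e); fV (edge_head e)].
  by have /orP[/andP[/eqP-> /eqP->]|/andP[/eqP-> /eqP->]] := fEP e; rewrite // finset.setUC.
apply: (euclidean_of_embedding iV _ ends dV) => e e' E.
apply: edge_ends_inj hT _; have := ends e; rewrite E ends => /set2_inj[[/iV-> /iV->]|[/iV-> /iV->]].
  by left.
by right.
Qed.

(** Without parallel arrows, each neighbor is counted at most once. *)
Lemma neighbor_sum_le x : 0 < d x -> neighbor_sum d x <= \sum_(y <- nbrs adj x) d y.
Proof.
move=> dx; rewrite big_filter big_enum_cond /=.
have -> : neighbor_sum d x = \sum_a \sum_y link a x y * d y.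
  apply: eq_bigr => a _; rewrite -(sum_select (fun y => (src a == x) * d y)).
  rewrite -(sum_select (fun y => (tgt a == x) * d y)) -big_split /=; apply: eq_bigr => y _.
  have [s|s] := eqVneq (src a) x; have [t|t] := eqVneq (tgt a) x; rewrite /link.
  - by have := no_loop (a := a); rewrite s t eqxx => /(_ dx).
  - by rewrite s eqxx /= (negbTE t) andbF orbF; lia.
  - by rewrite t (negbTE s) eqxx /= andbT; lia.
  - by rewrite (negbTE s) (negbTE t) andbF; lia.
rewrite exchange_big [leqRHS]big_mkcond /=; apply: leq_sum => y _; rewrite -big_distrl /=.
have [dy|] := posnP (d y); first by rewrite dy muln0.
move=> dy; rewrite /adj dx dy /=.
case: (boolP [exists a, link a x y]) => [/existsP[a la]|/existsPn nl]; last first.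
  by rewrite big1 // => a _; rewrite (negbTE (nl a)).
rewrite (bigD1 a) //= la big1 ?addn0 ?mul1n // => b ba.
apply/eqP; rewrite eqb0; apply: contra ba => lb; apply/eqP.
have link_set c : link c x y -> [set src c; tgt c] = [set x; y].
  by case/orP=> /andP[/eqP-> /eqP->] //; rewrite finset.setUC.
apply: no_parallel; first by rewrite !link_set.
  by case/orP: lb => /andP[/eqP-> _].
by case/orP: lb => /andP[_ /eqP->].
Qed.

(** Lowering d by one at x changes the Tits form by
    1 - 2 d(x) + neighbor_sum d x, and makes it positive. *)
Lemma subharmonic_of_minimal x : 0 < d x -> 2 * d x <= \sum_(y <- nbrs adj x) d y.
Proof.
move=> dx; apply: leq_trans (neighbor_sum_le dx).
pose d' y := d y - (y == x).
have d'x y : d y = d' y + (y == x).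
  by rewrite /d'; case: (eqVneq y x) => [->|_]; rewrite /= ?addn0 ?subn0 ?subnK.
have loopx a : (src a == x) && (tgt a == x) = false.
  apply/negP => /andP[/eqP s /eqP t].
  by have := no_loop (a := a); rewrite s t eqxx => /(_ dx).
have sqE : dim_group d + 1 = dim_group d' + 2 * d x.
  have s1 : \sum_(y : vertex Q) (x == y) * 1 = 1 by exact: (sum_select (fun=> 1)).
  have s2 : \sum_(y : vertex Q) (x == y) * (2 * d y) = 2 * d x.
    exact: (sum_select (fun y => 2 * d y)).
  rewrite /dim_group -s2 -[X in _ + X = _]s1 -!big_split /=.
  apply: eq_bigr => y _; rewrite [x == y]eq_sym.
  have := d'x y; case: (y == x); nia.
have edE : dim_rep d = dim_rep d' + neighbor_sum d x.
  rewrite /dim_rep /neighbor_sum -big_split /=; apply: eq_bigr => a _.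
  have := loopx a; have := d'x (src a); have := d'x (tgt a).
  case: (src a == x); case: (tgt a == x) => //= -> -> _; nia.
have lt : total_dim d' < total_dim d.
  rewrite /total_dim (bigD1 x) //= [ltnRHS](bigD1 x) //= -addSn leq_add //.
    by rewrite [leqRHS]d'x eqxx addn1.
  by apply: leq_sum => y _; rewrite [leqRHS]d'x leq_addr.
have [d'0|d'0] := pselect (exists y, 0 < d' y).
  have := d_min _ d'0 lt; rewrite /= => /(_ (fun y => leq_subr _ _)).
  move: d_neg; lia.
have z y : d' y = 0 by apply/eqP; rewrite -leqn0 leqNgt; apply/negP => dy; apply: d'0; exists y.
have : dim_rep d = 0.
  apply/eqP; rewrite /dim_rep sum_nat_eq0; apply/forallP => a /=.
  by rewrite !d'x !z !add0n; have := loopx a; case: (_ == x); case: (_ == x).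
have : 0 < dim_group d by rewrite /dim_group (bigD1 x) //= addn_gt0 muln_gt0 dx.
by move: d_neg; lia.
Qed.

(** If d(x) = 1 and x separates the support into two nonempty parts, the Tits form
    of d is q(d1) + q(d2) - 1, where d1 and d2 are the restrictions of d to the
    parts, both including x; it would be positive. *)
Lemma ge2_of_minimal : acyclic adj -> forall x, 2 <= size (nbrs adj x) -> 2 <= d x.
Proof.
move=> acyc x x2.
have [y1 [y2 [y12 xy1 xy2]]] : exists y1 y2, [/\ y1 != y2, adj x y1 & adj x y2].
  move: x2 (nbrs_uniq adj x) (mem_nbrs adj x).
  case: (nbrs adj x) => [|y1 [|y2 s]] //= _; rewrite inE negb_or => /andP[/andP[y12 _] _] mem.
  by exists y1, y2; split=> //; rewrite -mem !inE eqxx ?orbT.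
have dx := adj_gt0 xy1.
rewrite leqNgt; apply/negP => dx2; have dx1 : d x = 1 by move: dx dx2; lia.
(* A is the component of y1 once x is removed; y2 is not in it. *)
pose r' : rel (vertex Q) := fun u v => [&& adj u v, u != x & v != x].
have y1x : y1 != x by apply: contraTneq xy1 => ->; rewrite adj_irr.
have y2x : y2 != x by apply: contraTneq xy2 => ->; rewrite adj_irr.
have path_r p u : path r' u p -> path adj u p /\ x \notin p.
  elim: p u => //= v p IHp u /andP[/and3P[-> _ vx] /IHp[-> xp]].
  by rewrite inE negb_or eq_sym vx.
pose A := connect r' y1.
have A2 : ~~ A y2.
  apply/negP => /connectP[p0 p0P y2E]; case/shortenP: p0P y2E => p pP un _ y2E.
  have [pP' xp] := path_r _ _ pP.
  have := acyc (x :: y1 :: p); rewrite [cycle _ _]/= rcons_path pP' xy1 -y2E adj_sym xy2.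
  rewrite cons_uniq un inE negb_or xp eq_sym y1x => /(_ isT isT).
  by case: p y2E {pP un pP' xp} => //= y2E; rewrite y2E eqxx in y12.
have Ax : ~~ A x.
  apply/negP => /connectP[p pP xE]; have [_] := path_r _ _ pP.
  case/lastP: p {pP} xE => [|p z] /=; first by move=> xE; rewrite xE eqxx in y1x.
  by rewrite last_rcons mem_rcons inE => ->; rewrite eqxx.
pose d1 z := if A z || (z == x) then d z else 0.
pose d2 z := if A z then 0 else d z.
have clos s t : s != x -> t != x -> adj s t -> A s = A t.
  have r'_sym u v : r' u v = r' v u by rewrite /r' adj_sym; case: (adj v u); rewrite //= andbC.
  move=> sx tx st; apply/idP/idP => h; apply: connect_trans h _; apply: connect1.
    by rewrite /r' st sx tx.
  by rewrite /r' adj_sym st sx tx.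
have sqE : dim_group d + 1 = dim_group d1 + dim_group d2.
  have s1 : \sum_(y : vertex Q) (x == y) * 1 = 1 by exact: (sum_select (fun=> 1)).
  rewrite /dim_group -s1 -!big_split /=; apply: eq_bigr => y _; rewrite /d1 /d2.
  have [<-|xy] := eqVneq x y; first by rewrite (negbTE Ax) /= dx1.
  by case: (A y); rewrite /= ?muln0 ?addn0.
have edE : dim_rep d = dim_rep d1 + dim_rep d2.
  rewrite /dim_rep -!big_split /=; apply: eq_bigr => a _.
  have [s0|ds] := posnP (d (src a)); first by rewrite /d1 /d2 s0 !if_same !muln0.
  have [t0|dt] := posnP (d (tgt a)); first by rewrite /d1 /d2 t0 !if_same.
  have st := adj_arrow ds dt; rewrite /d1 /d2.
  have [sx|sx] := eqVneq (src a) x; have [tx|tx] := eqVneq (tgt a) x.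
  - by rewrite sx tx adj_irr in st.
  - by rewrite sx (negbTE Ax) orbF /=; case: (A _); rewrite ?muln0 ?addn0.
  - by rewrite tx (negbTE Ax) orbF /=; case: (A _); rewrite ?muln0 ?addn0.
  - by rewrite !orbF (clos _ _ sx tx st); case: (A _); rewrite ?muln0 ?addn0.
have lt_dim (e : vertex Q -> nat) z :
    (forall y, e y <= d y) -> e z = 0 -> 0 < d z -> total_dim e < total_dim d.
  move=> le_e ez dz; rewrite /total_dim (bigD1 z) //= [ltnRHS](bigD1 z) //= -addSn ez.
  by rewrite leq_add // leq_sum.
have dy1 : 0 < d y1 by apply: (@adj_gt0 _ x); rewrite adj_sym.
have dy2 : 0 < d y2 by apply: (@adj_gt0 _ x); rewrite adj_sym.
have le1 y : d1 y <= d y by rewrite /d1; case: ifP.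
have le2 y : d2 y <= d y by rewrite /d2; case: ifP.
have p1 : dim_rep d1 < dim_group d1.
  apply: d_min => //; first by exists x; rewrite /d1 eqxx orbT.
  by apply: (lt_dim _ y2) => //; rewrite /d1 (negbTE A2) (negbTE y2x).
have p2 : dim_rep d2 < dim_group d2.
  apply: d_min => //; first by exists x; rewrite /d2 (negbTE Ax).
  by apply: (lt_dim _ y1) => //; rewrite /d2 /A connect0.
by move: d_neg; lia.
Qed.

Lemma contains_euclidean_of_minimal : (exists x, 0 < d x) -> contains_euclidean d.
Proof.
move=> d0.
have [acyc|] := pselect (acyclic adj).
  have [T [hT nA]] :=
    acyclic_hosts adj_sym adj_irr adj_gt0 acyc (ge2_of_minimal acyc)
      subharmonic_of_minimal d0.
  by apply: contains_euclidean_of_hosts hT => n /nA.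
move=> /existsNP[c /not_implyP[cyc /not_implyP[un /negP]]]; rewrite -ltnNge => sz.
have [n [n2 hn]] := hosts_cycle adj_gt0 cyc un sz.
by apply: contains_euclidean_of_hosts hn => m [<-].
Qed.

End MinimalDimension.

Lemma contains_euclidean_of_nonpositive (Q : quiver) (d : vertex Q -> nat) :
  (exists x, 0 < d x) -> dim_group d <= dim_rep d -> contains_euclidean d.
Proof.
move=> d0 neg.
pose P n := exists d', [/\ (forall x, d' x <= d x), (exists x, 0 < d' x),
  dim_group d' <= dim_rep d' & total_dim d' = n].
have [n [[d' [le_d' d'0 neg' d'n]] dmin]] : exists n, P n /\ forall m, P m -> n <= m.
  by apply: nat_minimal; exists (total_dim d), d.
apply: (contains_euclidean_mono le_d').
have [[a [da st]]|nl] := pselect (exists a, 0 < d' (src a) /\ src a = tgt a).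
  exact: contains_euclidean_of_loop st da.
have no_loop a : 0 < d' (src a) -> src a != tgt a.
  by move=> da; apply/eqP => st; apply: nl; exists a.
have [[a [b [ab E ds dt]]]|np] := pselect (exists a b, [/\ a != b,
    [set src a; tgt a] = [set src b; tgt b], 0 < d' (src a) & 0 < d' (tgt a)]).
  exact: contains_euclidean_of_parallel ab (no_loop a ds) E ds dt.
apply: contains_euclidean_of_minimal => // [a b E ds dt|e le_e e0 lt].
  by apply: contrapT => /eqP ab; apply: np; exists a, b.
rewrite ltnNge; apply/negP => nege; move: lt; rewrite d'n ltnNge => /negP; apply.
by apply: dmin; exists e; split=> // x; apply: leq_trans (le_e x) (le_d' x).
Qed.

(** * The minimal representation infinite settings *)

Theorem corollary2 (k : closedFieldType) (S : quiver_setting) :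
  euclidean_setting S <-> minimal_rep_infinite k S.
Proof.
have eucl_inf E : euclidean_setting E -> rep_infinite k E.
  move=> /euclidean_setting_props[hE _ pE [x _]]; case: E hE pE x => Q d hE pE x.
  apply: rep_infinite_of_nonpositive; first by exists x; exact: pE.
  exact: harmonic_dim_group_le.
have inf_eucl E : rep_infinite k E -> exists E', euclidean_setting E' /\ qs_le E' E.
  case: E => Q d infE; apply: contrapT => nE; apply: infE.
  apply: rep_finite_of_finitely_many; apply: finitely_many_of_positive => e le_e e0.
  rewrite ltnNge; apply/negP => neg; apply: nE.
  exact: contains_euclidean_mono le_e (contains_euclidean_of_nonpositive e0 neg).
have le_trans A B C : qs_le A B -> qs_le B C -> qs_le A C.
  move=> [f0 [f1 [fm f0i f1i fd]]] [g0 [g1 [gm g0i g1i gd]]].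
  exists (g0 \o f0), (g1 \o f1); split.
  - move=> a /=; have [-> ->] := gm (f1 a); have [-> ->] := fm a; exact.
  - exact: inj_comp.
  - exact: inj_comp.
  - by move=> x; apply: leq_trans (fd x) (gd _).
split=> [eS|[infS minS]].
  split; first exact: eucl_inf.
  move=> S' /inf_eucl[E [eE leE]] leS.
  apply: (le_trans _ _ _ _ leE); apply: euclidean_antichain (le_trans _ _ _ leE leS);
    exact: euclidean_setting_props.
have [E [eE leE]] := inf_eucl _ infS.
exact: euclidean_setting_equiv leE (minS _ (eucl_inf _ eE) leE) eE.
Qed.
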